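(* Let $n\ge 3$, $m\ge 1$, $1<\alpha\le\frac{n+2}{n-2}$, and let $\mathbf u=(u_1,\dots,u_m)$ be a nonnegative solution of $-\Delta\mathbf u=|\mathbf u|^{\alpha-1}\mathbf u$ in $\mathbb R^n$. (i) If $1<\alpha<\frac{n+2}{n-2}$, then $\mathbf u$ is trivial. (ii) If $\alpha=\frac{n+2}{n-2}$, then $\mathbf u$ is of the form $$\mathbf u(x)=(n(n-2))^{\frac{n-2}{4}}\left(\frac{r}{r^2+|x-z|^2}\right)^{\frac{n-2}{2}}\mathbf e$$ for some $z\in\mathbb R^n$, $r\ge 0$ and a unit nonnegative vector $\mathbf e\in\mathbb R^m$.
   Context: For $\mathbf a\in\mathbb R^m$, $|\mathbf a|=(\sum_{i=1}^m a_i^2)^{1/2}$, and $\mathbf a$ is nonnegative if all $a_i\ge 0$. A nonnegative solution of the system in an open set $\Omega\subset\mathbb R^n$ is a $C^2$ function $\mathbf u:\Omega\to\mathbb R^m$ with all components nonnegative, satisfying the system pointwise. ''Trivial'' means identically zero. When $r=0$ the right-hand side of the formula in (ii) is understood to be identically zero. *)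

(* Defs.v *)
From HB Require Import structures.
From mathcomp Require Import all_boot all_order all_algebra.
From mathcomp Require Import all_classical all_reals all_analysis.

Set Implicit Arguments.
Unset Strict Implicit.
Unset Printing Implicit Defensive.

Import Order.TTheory GRing.Theory Num.Theory.
Import numFieldNormedType.Exports.

Local Open Scope classical_set_scope.
Local Open Scope ring_scope.

(* The library norm `|a| on row vectors is the sup norm: it induces the same
   topology (hence the same continuity and derivatives), but it is not the
   norm |a| of the equation. *)
Definition enorm (R : realType) (k : nat) (a : 'rV[R]_k) : R :=
  Num.sqrt (\sum_i a 0 i ^+ 2).

Definition nonneg_vec (R : realType) (k : nat) (a : 'rV[R]_k) : Prop :=
  forall i, 0 <= a 0 i.

Definition partial (R : realType) (n m : nat) (i : 'I_n)
    (f : 'rV[R]_n -> 'rV[R]_m) : 'rV[R]_n -> 'rV[R]_m :=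
  fun x => 'D_(delta_mx 0 i) f x.

Definition partial_exists (R : realType) (n m : nat) (Omega : set 'rV[R]_n)
    (i : 'I_n) (f : 'rV[R]_n -> 'rV[R]_m) : Prop :=
  forall x, Omega x -> derivable f x (delta_mx 0 i).

Definition continuous_on (R : realType) (n m : nat) (Omega : set 'rV[R]_n)
    (f : 'rV[R]_n -> 'rV[R]_m) : Prop :=
  forall x, Omega x -> {for x, continuous f}.

(* Functions on Omega are represented by total functions. For open Omega,
   continuity and derivatives at points of Omega do not depend on the values
   taken outside Omega. *)
Definition C2_on (R : realType) (n m : nat) (Omega : set 'rV[R]_n)
    (f : 'rV[R]_n -> 'rV[R]_m) : Prop :=
  [/\ continuous_on Omega f,
      forall i, partial_exists Omega i f /\ continuous_on Omega (partial i f) &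
      forall i j, partial_exists Omega i (partial j f) /\
                  continuous_on Omega (partial i (partial j f))].

Definition laplacian (R : realType) (n m : nat)
    (f : 'rV[R]_n -> 'rV[R]_m) : 'rV[R]_n -> 'rV[R]_m :=
  fun x => \sum_(i < n) partial i (partial i f) x.

Definition nonneg_solution (R : realType) (n m : nat) (alpha : R)
    (Omega : set 'rV[R]_n) (u : 'rV[R]_n -> 'rV[R]_m) : Prop :=
  [/\ open Omega,
      C2_on Omega u,
      forall x, Omega x -> nonneg_vec (u x) &
      forall x, Omega x -> - laplacian u x = (enorm (u x) `^ (alpha - 1)) *: u x].

Definition crit_exp (R : realType) (n : nat) : R := (n%:R + 2) / (n%:R - 2).

Definition bubble (R : realType) (n : nat) (z : 'rV[R]_n) (r : R)
    (x : 'rV[R]_n) : R :=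
  (n%:R * (n%:R - 2)) `^ ((n%:R - 2) / 4) *
  (r / (r ^+ 2 + enorm (x - z) ^+ 2)) `^ ((n%:R - 2) / 2).

(* The case r = 0 needs no separate clause: the quotient is 0, also at x = z
   where it is 0 / 0 = 0, and its power is 0 since the exponent is nonzero. *)
Lemma bubble0 (R : realType) (n : nat) (z x : 'rV[R]_n) :
  (3 <= n)%N -> bubble z 0 x = 0.
Proof.
move=> n3; rewrite /bubble mul0r powR0 ?mulr0//.
rewrite mulf_neq0 ?invr_eq0 ?pnatr_eq0// subr_eq0 eqr_nat.
by case: n n3 {z x} => [|[|[|n]]].
Qed.

(* Main.v *)
Require Import Defs.
From HB Require Import structures.
From mathcomp Require Import all_boot all_order all_algebra.
From mathcomp Require Import all_classical all_reals all_analysis.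
From mathcomp Require Import ring lra.
Import Order.TTheory GRing.Theory Num.Theory.
Import numFieldNormedType.Exports.
Local Open Scope classical_set_scope.
Local Open Scope ring_scope.

(** The proof is the method of moving spheres, carried out with nothing but
    the maximum principle for the Laplacian.

    Put k = (n-2)/2, p = alpha - 1, and let |z|^2 be written nsq z. For c > 0
    the Kelvin transform of u about the origin in the sphere |z|^2 = c is
    (c/|z|^2)^k u(c z/|z|^2); transforms about other centres are obtained by
    translating u; spheres are parametrised by their squared radius c. If
    q = c/|z|^2, the transform b of a solution satisfies
    - Delta b = q^(2-kp) |b|^p b, where kp <= 2 because alpha is at most
    critical, with equality exactly in the critical case.

    Since the nonlinearity is cooperative, the system obeys a comparison
    principle for the differences u - b outside the sphere, in regions that
    carry a positive function g with Delta g negative enough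
    (system_comparison). Three such regions are enough: the whole exterior of
    a small sphere and a neighbourhood of infinity, both with
    g = |z|^(-1/2), and a thin shell just outside the sphere, with a parabola in
    |z|^2. So b <= u outside small spheres (kelvin_le_start), and if
    b <= u holds at c, strictly in every nonzero component, it persists for
    slightly larger values of c (kelvin_le_continuation). When the spheres
    cannot be enlarged for ever, the strong maximum principle therefore forces
    a nonzero component of u to agree with its transform; comparing the two
    equations then gives kp = 2 and u = b (moving_spheres_dichotomy).

    If the inequality holds for all centres and all radii, letting the centre
    go to infinity along a line shows that u is constant, hence zero
    (kelvin_le_const, const_solution_zero). This settles the subcritical case.

    In the critical case a nonzero u has, by comparing behaviours at infinity
    (infinity_le), at each centre x a number c(x) with u equal to its
    transform, and c(x)^k u(x) = L is the limit of |y|^(2k) u(y) along a ray,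
    which does not depend on x. Hence u(x) = c(x)^(-k) L, and the invariance of
    u becomes a functional equation for c. Its asymptotics show that c is a
    monic quadratic polynomial along every line of unit speed
    (inversion_equation_quadratic), so c(x) - |x|^2 is affine and
    c(x) = r^2 + |x - z|^2. The equation at z determines |L|.

    Second derivatives are only taken along coordinate lines: jet2 records the
    two derivatives of a function of one variable at a point, and lapl the
    Laplacian so obtained. Only the solution u itself needs a chain rule
    in several variables. *)

(** * Functions with continuous partial derivatives are differentiable *)

Section line.
Set Implicit Arguments.
Unset Strict Implicit.
Variables (R : realType) (n : nat).
Implicit Types (f : 'rV[R]_n -> R).

Lemma is_derive_line f (v y : 'rV[R]_n) (t : R) :
  derivable f (t *: v + y) v ->
  is_derive t (1 : R) (fun s : R => f (s *: v + y)) ('D_v f (t *: v + y)).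
Proof.
have e : (fun h : R => h^-1 *: (f ((h *: (1 : R) + t) *: v + y) - f (t *: v + y)))
       = (fun h : R => h^-1 *: (f (h *: v + (t *: v + y)) - f (t *: v + y))).
  by apply/funext => h; rewrite [h *: 1]mulr1 scalerDl addrA.
by move=> d; split; rewrite /derivable /derive /= e.
Qed.

(** The vector h with all coordinates of index at least j replaced by 0. The
    vectors trunc 0 h, ..., trunc n h form a path from 0 to h with steps
    parallel to the axes. *)
Definition trunc (j : nat) (h : 'rV[R]_n) : 'rV[R]_n :=
  \row_i (if (i < j)%N then h 0 i else 0).

Lemma truncS (j : 'I_n) h : trunc j.+1 h = h 0 j *: delta_mx 0 j + trunc j h.
Proof.
apply/rowP => i; rewrite !mxE /= ltnS leq_eqVlt.
have [->|ij] := eqVneq i j; first by rewrite eqxx ltnn mulr1 addr0.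
by rewrite (negbTE (_ : (i != j :> nat)%N)) // mulr0 add0r.
Qed.

Lemma trunc0 h : trunc 0 h = 0.
Proof. by apply/rowP => i; rewrite !mxE. Qed.

Lemma truncn h : trunc n h = h.
Proof. by apply/rowP => i; rewrite !mxE ltn_ord. Qed.

Lemma row_norm_le (h : 'rV[R]_n) e : 0 <= e ->
  (forall i, `|h 0 i| <= e) -> `|h| <= e.
Proof.
move=> e0 H; rewrite /Num.Def.normr/= mx_normrE (bigmax_le _ e0)//= => -[i j] _.
by rewrite (ord1 i).
Qed.

Lemma coord_le_norm (h : 'rV[R]_n) i : `|h 0 i| <= `|h|.
Proof.
rewrite [leRHS]/Num.Def.normr/= mx_normrE; exact: (le_bigmax _ _ (ord0, i)).
Qed.

(** Mean value estimate for one step parallel to an axis. *)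
Lemma coord_step f (i : 'I_n) (x y : 'rV[R]_n) (s e : R) :
  (forall z, derivable f z (delta_mx 0 i)) ->
  (forall t : R, `|t| <= `|s| ->
     `|'D_(delta_mx 0 i) f x - 'D_(delta_mx 0 i) f (t *: delta_mx 0 i + y)| <= e) ->
  `|f (s *: delta_mx 0 i + y) - f y - s * 'D_(delta_mx 0 i) f x| <= e * `|s|.
Proof.
move=> df H.
pose F (t : R) : R := f (t *: delta_mx 0 i + y).
pose dF (t : R) : R := 'D_(delta_mx 0 i) f (t *: delta_mx 0 i + y).
have dFP (t : R) : is_derive t (1 : R) F (dF t) by exact: is_derive_line.
have cF a b : {within `[a, b], continuous F}.
  apply/continuous_subspaceT => r.
  by apply/differentiable_continuous/derivable1_diffP; case: (dFP r).
have F0 : f y = F 0 by rewrite /F scale0r add0r.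
suff [c cs e1] : exists2 c, `|c| <= `|s| & F s - F 0 = dF c * s.
  rewrite -/(F s) F0 e1 (mulrC (dF c)) -mulrBr normrM mulrC ler_wpM2r//.
  by rewrite distrC; exact: H.
have [s0|s0] := leP 0 s.
  have [c + ec] := MVT_segment s0 (fun x _ => dFP x) (cF _ _).
  rewrite in_itv/= => /andP[c0 cs]; exists c; last by rewrite ec subr0.
  by rewrite !ger0_norm.
have [c + ec] := MVT_segment (ltW s0) (fun x _ => dFP x) (cF _ _).
rewrite in_itv/= => /andP[c0 cs]; exists c.
  by rewrite !ler0_norm ?lerN2 // ltW.
by rewrite -opprB ec sub0r mulrN opprK.
Qed.

Lemma cvg_sum_ord (T : Type) (F : set_system T) (k : nat) (f : 'I_k -> T -> R)
    (a : 'I_k -> R) : Filter F ->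
  (forall i, f i x @[x --> F] --> a i) ->
  \sum_i f i x @[x --> F] --> \sum_i a i.
Proof. by move=> FF H; apply: cvg_big => //; exact: add_continuous. Qed.

(** The would-be differential with coefficients a, as a continuous linear
    map. *)
Lemma grad_linear_ex (a : 'I_n -> R) :
  exists2 L : {linear 'rV[R]_n -> R}, continuous L & forall h, L h = \sum_i h 0 i * a i.
Proof.
pose g (h : 'rV[R]_n) : R := \sum_i h 0 i * a i.
have gl : linear g.
  move=> k u v; rewrite /g scaler_sumr -big_split /=; apply: eq_bigr => i _.
  by rewrite !mxE mulrDl -mulrA.
pose isL := GRing.isLinear.Build _ _ _ _ g gl.
pose L : {linear 'rV[R]_n -> R} := HB.pack g isL.
exists L => // x.
rewrite /L /= /g; change (\sum_i y 0 i * a i @[y --> nbhs x] --> \sum_i x 0 i * a i).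
apply: cvg_sum_ord => i; apply: cvgMl; exact: coord_continuous.
Qed.

Lemma C1_differentiable f :
  (forall i x, derivable f x (delta_mx 0 i)) ->
  (forall i, continuous ('D_(delta_mx 0 i) f)) ->
  forall x, differentiable f x.
Proof.
move=> df cf x.
have [L cL LE] := grad_linear_ex (fun i => 'D_(delta_mx 0 i) f x).
suff fo : f \o shift x = cst (f x) + L +o_ 0 id.
  by apply/diff_locallyP; rewrite (diff_unique cL fo).
apply/eqaddoP => e e0.
(* n.+1 rather than n, to allow n = 0 *)
pose e' := e / n.+1%:R.
have e'0 : 0 < e' by rewrite divr_gt0.
have : \forall y \near x, forall i,
    `|'D_(delta_mx 0 i) f x - 'D_(delta_mx 0 i) f y| <= e'.
  have H0 i : \forall y \near x,
      `|'D_(delta_mx 0 i) f x - 'D_(delta_mx 0 i) f y| <= e'.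
    by have /cvgrPdist_le/(_ _ e'0) := cf i x.
  exact: filter_forall H0.
move=> /nbhs_ballP[d /= d0 H].
near=> h.
have hd : `|h| < d.
  near: h; apply/nbhs_ballP; exists d => // h.
  by rewrite -ball_normE /= sub0r normrN.
rewrite /= !fctE /= LE opprD addrA [h + x]addrC.
have -> : f (x + h) - f x = \sum_(j < n) (f (trunc j.+1 h + x) - f (trunc j h + x)).
  rewrite -(big_mkord xpredT (fun j => f (trunc j.+1 h + x) - f (trunc j h + x))).
  rewrite telescope_sumr// trunc0 truncn add0r; congr (f _ - _); exact: addrC.
rewrite -sumrB (le_trans (ler_norm_sum _ _ _))//.
apply: (@le_trans _ _ (\sum_(j < n) e' * `|h|)); last first.
  rewrite sumr_const card_ord -mulr_natr.
  have q : n%:R / n.+1%:R <= 1 :> R by rewrite ler_pdivrMr // mul1r ler_nat.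
  rewrite (_ : _ * _ = e * `|h| * (n%:R / n.+1%:R)); last by rewrite /e'; ring.
  by rewrite ler_piMr // mulr_ge0 // ltW.
apply: ler_sum => j _.
rewrite truncS -[_ *: _ + _ + x]addrA.
have Hs := @coord_step f j x (trunc j h + x) (h 0 j) e' (df j).
apply: le_trans (Hs _) _; first last.
- by rewrite ler_pM2l// coord_le_norm.
- move=> t ht; apply: H => /=; rewrite -ball_normE /=.
  rewrite (_ : x - _ = - (t *: delta_mx 0 j + trunc j h)) ?normrN; last first.
    by rewrite addrA (opprD (_ + _)) addrCA subrr addr0.
  apply: le_lt_trans hd; apply: row_norm_le => // i; rewrite !mxE /=.
  have [->|ij] := eqVneq i j.
    by rewrite ltnn mulr1 ?addr0 ?add0r (le_trans ht)// coord_le_norm.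
  rewrite mulr0 ?addr0 ?add0r; case: ifP => _; first exact: coord_le_norm.
  by rewrite normr0.
Unshelve. all: by end_near. Qed.

End line.

(** * Second order jets of functions of one variable *)

Section jets.
Set Implicit Arguments.
Unset Strict Implicit.
Variables (R : realType).
Implicit Types (h f g : R -> R) (a b c d t : R).

(** First and second derivative a, b of h at t: near t the function h has a
    derivative g, with g t = a, and g has derivative b at t. *)
Definition jet2 h t a b := exists g : R -> R,
  [/\ \forall s \near t, is_derive (s : R) (1 : R) h (g s), g t = a &
      is_derive (t : R) (1 : R) g b].

Lemma jet2_derive h t a b : jet2 h t a b -> is_derive t (1 : R) h a.
Proof. by move=> [g [+ <- _]] => /nbhs_singleton. Qed.

Lemma is_derive_cvg h t a : is_derive t (1 : R) h a -> h s @[s --> t] --> h t.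
Proof.
by move=> [dh _]; apply: differentiable_continuous; exact/derivable1_diffP.
Qed.

Lemma jet2_cvg h t a b : jet2 h t a b -> h s @[s --> t] --> h t.
Proof. by move=> /jet2_derive /is_derive_cvg. Qed.

Lemma is_derive_uniq h t a b :
  is_derive t (1 : R) h a -> is_derive t (1 : R) h b -> a = b.
Proof. by move=> [_ <-] [_ <-]. Qed.

Lemma jet2_uniq h t a b c d : jet2 h t a b -> jet2 h t c d -> b = d.
Proof.
move=> [g1 [h1 _ d1]] [g2 [h2 _ d2]].
apply: is_derive_uniq d1 _; apply: near_eq_is_derive d2.
near=> s; apply: (@is_derive_uniq h s); [near: s; exact: h2|near: s; exact: h1].
Unshelve. all: by end_near. Qed.

Lemma jet2_ext f h t a b : (\forall s \near t, f s = h s) ->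
  jet2 f t a b -> jet2 h t a b.
Proof.
move=> fh [g [hg ga gb]]; exists g; split => //.
near=> s; apply: (@near_eq_is_derive _ _ _ f); last by near: s.
by near: s; exact: nbhs_interior fh.
Unshelve. all: by end_near. Qed.

Lemma jet2_eq f t a b c d : jet2 f t a b -> a = c -> b = d -> jet2 f t c d.
Proof. by move=> ? <- <-. Qed.

Lemma jet2_cst c t : jet2 (fun=> c) t 0 0.
Proof.
by exists (fun=> 0); split => //; [near=> s|]; exact: is_derive_cst.
Unshelve. all: by end_near. Qed.

Lemma jet2_id t : jet2 id t 1 0.
Proof.
exists (fun=> 1); split => //; last exact: is_derive_cst.
by near=> s; exact: is_derive_id.
Unshelve. all: by end_near. Qed.

Lemma jet2D f h t a b c d : jet2 f t a b -> jet2 h t c d ->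
  jet2 (fun s => f s + h s) t (a + c) (b + d).
Proof.
move=> [g1 [h1 <- d1]] [g2 [h2 <- d2]]; exists (fun s => g1 s + g2 s); split => //.
  by near=> s; apply: is_deriveD; near: s.
exact: is_deriveD.
Unshelve. all: by end_near. Qed.

Lemma jet2Z f t a b k : jet2 f t a b -> jet2 (fun s => k * f s) t (k * a) (k * b).
Proof.
move=> [g1 [h1 <- d1]]; exists (fun s => k * g1 s); split => //.
  by near=> s; apply: is_deriveZ; near: s.
exact: is_deriveZ.
Unshelve. all: by end_near. Qed.

Lemma jet2M f h t a b c d : jet2 f t a b -> jet2 h t c d ->
  jet2 (fun s => f s * h s) t (a * h t + f t * c)
    (b * h t + 2 * (a * c) + f t * d).
Proof.
move=> jf jh; have [f' h'] := (jet2_derive jf, jet2_derive jh).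
case: jf jh => [g1 [h1 e1 d1]] [g2 [h2 e2 d2]].
exists (fun s => g1 s * h s + f s * g2 s); split; last 1 first.
- have H := is_deriveD (is_deriveM d1 h') (is_deriveM f' d2).
  apply: is_derive_eq H _; rewrite e1 e2 /GRing.scale /=; ring.
- near=> s; have H1 : is_derive s (1 : R) f (g1 s) by near: s.
  have H2 : is_derive s (1 : R) h (g2 s) by near: s.
  by apply: is_derive_eq (is_deriveM H1 H2) _; rewrite /GRing.scale /=; ring.
- by rewrite e1 e2.
Unshelve. all: by end_near. Qed.

Lemma jet2_comp F h t a b c d : jet2 h t a b -> jet2 F (h t) c d ->
  jet2 (fun s => F (h s)) t (c * a) (d * a ^+ 2 + c * b).
Proof.
move=> jh jF; have ch := jet2_cvg jh; have h' := jet2_derive jh.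
have F' := jet2_derive jF.
case: jh jF => [g1 [h1 e1 d1]] [g2 [h2 e2 d2]].
exists (fun s => g2 (h s) * g1 s); split; last 1 first.
- apply: is_derive_eq (is_deriveM (is_derive1_comp d2 h') d1) _.
  by rewrite /GRing.scale /= e1 e2; ring.
- have h2' : \forall s \near t, is_derive (h s) (1 : R) F (g2 (h s)) by exact: (ch _ h2).
  by near=> s; apply: (@is_derive1_comp _ F h); near: s.
- by rewrite e1 e2.
Unshelve. all: by end_near. Qed.

Lemma jet2_powR (s x : R) : 0 < x ->
  jet2 (fun y => y `^ s) x (s * x `^ (s - 1)) (s * ((s - 1) * x `^ (s - 2))).
Proof.
move=> x0; exists (fun y => s * y `^ (s - 1)); split => //.
  near=> y; apply: is_derive1_powR; near: y; exact: lt_nbhsr.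
have H := is_deriveZ s (is_derive1_powR (s - 1) x0).
apply: is_derive_eq H _; by rewrite (_ : s - 1 - 1 = s - 2) //; ring.
Unshelve. all: by end_near. Qed.

Lemma jet2_inv (x : R) : x != 0 -> jet2 (fun y => y^-1) x (- x ^- 2) (2 * x ^- 3).
Proof.
move=> x0; exists (fun y => - y ^- 2); split => //.
  near=> y; have y0 : y != 0 by near: y; apply: (@cvgr_neq0 _ _ _ (nbhs x) _ id x) => //; exact: cvg_id.
  apply: is_derive_eq (@is_deriveV _ id y 1 1 y0 (is_derive_id _ _)) _.
  by rewrite /GRing.scale /= mulr1.
have x2 : x ^+ 2 != 0 by rewrite expf_neq0.
have H := @is_deriveV _ (fun y : R => y ^+ 2) x _ 1 x2 (is_deriveX 2 (is_derive_id x (1 : R))).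
apply: is_derive_eq (is_deriveN H) _.
by rewrite /GRing.scale /=; field.
Unshelve. all: by end_near. Qed.

(** Second derivative test: otherwise the derivative would be negative just
    after t, and h would fall below its minimum. *)
Lemma jet2_min h t a b : jet2 h t a b -> (\forall s \near t, h t <= h s) -> 0 <= b.
Proof.
move=> [g [hg ga gb]] hmin; rewrite leNgt; apply/negP => b0.
have : \forall s \near t, is_derive (s : R) (1 : R) h (g s) /\ h t <= h s.
  by near=> s; split; near: s.
move=> /nbhs_ballP[e /= e0 He].
have dh s : s \in `]t - e, t + e[%R -> is_derive s (1 : R) h (g s).
  by move=> se; apply: (He s _).1; rewrite -ball_normE /= ltr_distlC; move: se; rewrite in_itv.
have tin : t \in `]t - e, t + e[%R by rewrite in_itv /= ltrDl ltrBlDr ltrDl e0.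
have gt0 : g t = 0.
  apply: (is_derive_uniq (dh t tin)).
  apply: (@derive1_at_min _ h (t - e) (t + e)) => //.
  - by rewrite lerD2l ge0_cp // ltW.
  - by move=> s /dh [].
  - by move=> s se; apply: (He s _).2; rewrite -ball_normE /= ltr_distlC; move: se; rewrite in_itv.
have : s^-1 *: (g (s *: (1 : R) + t) - g t) @[s --> 0^'] --> b.
  by case: gb => + <-; exact.
move=> /cvgr_lt/(_ 0 b0); rewrite near_withinE => /nbhs_ballP[r /= r0 Hr].
pose m := Num.min e r.
have m0 : 0 < m by rewrite lt_min e0 r0.
have mN : t < t + m / 2 by rewrite ltrDl divr_gt0.
have gneg s : s \in `]t, (t + m / 2)[%R -> g s < 0.
  rewrite in_itv /= => /andP[ts sm].
  have st0 : 0 < s - t by rewrite subr_gt0.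
  have : (s - t)^-1 *: (g ((s - t) *: (1 : R) + t) - g t) < 0.
    apply: Hr; last by rewrite gt_eqF.
    rewrite -ball_normE /= sub0r normrN gtr0_norm // ltrBlDl.
    apply: lt_le_trans sm _; rewrite lerD2l.
    have : m <= r by rewrite ge_min lexx orbT.
    by lra.
  rewrite gt0 subr0 [(s - t) *: 1]mulr1 subrK /GRing.scale /= pmulr_rlt0 //.
  by rewrite invr_gt0.
have sub s : s \in `]t, (t + m / 2)[%R -> s \in `]t - e, t + e[%R.
  rewrite !in_itv /= => /andP[ts sm].
  have : m <= e by rewrite ge_min lexx.
  by lra.
have hc : {within `[t, t + m / 2], continuous h}.
  apply: derivable_within_continuous => s; rewrite in_itv /= => /andP[ts sm].
  have [] // := dh s _; rewrite in_itv /=.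
  have : m <= e by rewrite ge_min lexx.
  by lra.
have [c cin E] := @MVT _ h g t (t + m / 2) mN (fun x xin => dh x (sub x xin)) hc.
have : h t <= h (t + m / 2).
  apply: (He _ _).2; rewrite -ball_normE /= opprD addNKr normrN gtr0_norm ?divr_gt0 //.
  have : m <= e by rewrite ge_min lexx.
  by lra.
rewrite -subr_ge0 E addrAC subrr add0r leNgt => /negP; apply.
by rewrite pmulr_llt0 ?divr_gt0 // gneg.
Unshelve. all: by end_near. Qed.

End jets.

(** * The Laplacian, radial functions and the Kelvin transform *)

Section laplacian_jets.
Set Implicit Arguments.
Unset Strict Implicit.
Variables (R : realType) (n : nat).
Implicit Types (f F G : 'rV[R]_n -> R) (z : 'rV[R]_n).

Local Notation "''e_' i" := (delta_mx 0 i : 'rV[R]_n) (at level 8, i at level 2, format "''e_' i").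

(** The square of the Euclidean norm. *)
Definition nsq z : R := \sum_i z 0 i ^+ 2.

(** F has Laplacian l at z, in the sense that its restrictions to the
    coordinate lines through z have second order jets at z, whose second
    derivatives add up to l. *)
Definition lapl F z (l : R) := exists a b : 'I_n -> R,
  (forall i, jet2 (fun t : R => F (z + t *: 'e_i)) 0 (a i) (b i)) /\ l = \sum_i b i.

(** Scalar functions that are differentiable together with their partial
    derivatives. No continuity of the second derivatives is required. *)
Definition C2_fun f := (forall x, differentiable f x) /\
  (forall k x, differentiable ('D_'e_k f) x).

(** The Laplacian of a twice differentiable function, as a sum of iterated
    directional derivatives. *)
Definition laplace f z : R := \sum_k 'D_'e_k ('D_'e_k f) z.

Lemma is_derive_curve f (g : 'I_n -> R -> R) (t : R) (a : 'I_n -> R) :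
  differentiable f (\row_j g j t) ->
  (forall j, is_derive t (1 : R) (g j) (a j)) ->
  is_derive t (1 : R) (fun s => f (\row_j g j s))
    (\sum_j a j * 'D_'e_j f (\row_j g j t)).
Proof.
move=> df dg.
pose M (s : R) : 'rV[R]_n := \row_j g j s.
have dM : derivable M t (1 : R).
  apply/derivable_mxP => i j.
  rewrite (_ : (fun x => M x i j) = g j); first by case: (dg j).
  by apply/funext => s; rewrite mxE.
have DM : 'D_1 M t = \row_j a j.
  rewrite derive_mx //; apply/rowP => j; rewrite !mxE.
  rewrite (_ : (fun x => M x 0 j) = g j); first by case: (dg j).
  by apply/funext => s; rewrite mxE.
have dM' : differentiable M t by exact/derivable1_diffP.
have dc : differentiable (f \o M) t by exact: differentiable_comp.
suff E : 'D_1 (f \o M) t = \sum_j a j * 'D_'e_j f (\row_j g j t).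
  by split; [exact/derivable1_diffP | exact: E].
rewrite deriveE // diff_comp //= -(deriveE _ dM') DM.
rewrite [X in 'd f _ X]row_sum_delta linear_sum /=; apply: eq_bigr => j _.
by rewrite linearZ /= mxE deriveE.
Qed.

(** Second order chain rule along the curve with coordinates g j. *)
Lemma jet2_curve f (g : 'I_n -> R -> R) (t : R) (a b : 'I_n -> R) :
  C2_fun f -> (forall j, jet2 (g j) t (a j) (b j)) ->
  let x := \row_j g j t in
  jet2 (fun s => f (\row_j g j s)) t (\sum_j a j * 'D_'e_j f x)
   (\sum_j (b j * 'D_'e_j f x + a j * \sum_l a l * 'D_'e_l ('D_'e_j f) x)).
Proof.
move=> [df ddf] jg x.
have [g' g'P] := fin_all_exists jg.
exists (fun s => \sum_j g' j s * 'D_'e_j f (\row_j g j s)); split.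
- have H j : \forall s \near t, is_derive (s : R) (1 : R) (g j) (g' j s) by case: (g'P j).
  near=> s; apply: is_derive_curve; [exact: df|near: s; exact: filter_forall H].
- by apply: eq_bigr => j _; case: (g'P j) => _ -> _.
- have H j : is_derive (t : R) (1 : R) (fun s => g' j s * 'D_'e_j f (\row_j g j s))
     (b j * 'D_'e_j f x + a j * \sum_l a l * 'D_'e_l ('D_'e_j f) x).
    have [h1 h2 h3] := g'P j.
    have h4 : is_derive (t : R) (1 : R) (fun s => 'D_'e_j f (\row_j g j s))
       (\sum_l a l * 'D_'e_l ('D_'e_j f) x).
      by apply: is_derive_curve => // l; exact: jet2_derive (jg l).
    apply: is_derive_eq (is_deriveM h3 h4) _.
    by rewrite /GRing.scale /= h2 addrC [_ * b j]mulrC.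
  have := is_derive_sum H.
  rewrite (_ : \sum_(i < n) _ = (fun s => \sum_j g' j s * 'D_'e_j f (\row_j g j s)))//.
  by apply/funext => s; rewrite fct_sumE.
Unshelve. all: by end_near. Qed.

Lemma lapl_C2 f z : C2_fun f -> lapl f z (laplace f z).
Proof.
move=> [df ddf]; exists (fun i => 'D_'e_i f z), (fun i => 'D_'e_i ('D_'e_i f) z).
split => // i; exists (fun t => 'D_'e_i f (z + t *: 'e_i)).
have H (h : 'rV[R]_n -> R) (t : R) : (forall x, differentiable h x) ->
   is_derive t (1 : R) (fun s => h (z + s *: 'e_i)) ('D_'e_i h (z + t *: 'e_i)).
  move=> dh; under eq_fun do rewrite addrC; rewrite addrC; apply: is_derive_line.
  exact: diff_derivable.
split.
- by near=> t; exact: H.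
- by rewrite scale0r addr0.
- by have := H ('D_'e_i f) 0 (ddf i); rewrite scale0r addr0.
Unshelve. all: by end_near. Qed.

Lemma lapl_uniq F z k l : lapl F z k -> lapl F z l -> k = l.
Proof.
move=> [a [b [j1 ->]]] [c [d [j2 ->]]]; apply: eq_bigr => i _.
exact: jet2_uniq (j1 i) (j2 i).
Qed.

Lemma cvg_coord_line z (i : 'I_n) : (z + t *: 'e_i) @[t --> (0 : R)] --> z.
Proof.
suff : (z + t *: 'e_i) @[t --> (0 : R)] --> z + (0 : R) *: 'e_i.
  by rewrite scale0r addr0.
by apply: cvgD; [exact: cvg_cst|apply: cvgZr_tmp; exact: cvg_id].
Qed.

Lemma lapl_ext F G z l : (\forall y \near z, F y = G y) -> lapl F z l -> lapl G z l.
Proof.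
move=> FG [a [b [j1 ->]]]; exists a, b; split => // i.
apply: jet2_ext (j1 i); exact: (@cvg_coord_line z i _ FG).
Qed.

Lemma laplD F G z k l : lapl F z k -> lapl G z l ->
  lapl (fun y => F y + G y) z (k + l).
Proof.
move=> [a [b [j1 ->]]] [c [d [j2 ->]]].
exists (fun i => a i + c i), (fun i => b i + d i); split; last by rewrite big_split.
by move=> i; exact: jet2D (j1 i) (j2 i).
Qed.

Lemma laplZ F z k c : lapl F z k -> lapl (fun y => c * F y) z (c * k).
Proof.
move=> [a [b [j1 ->]]]; exists (fun i => c * a i), (fun i => c * b i).
by split; [move=> i; exact: jet2Z (j1 i)|rewrite mulr_sumr].
Qed.

Lemma laplB F G z k l : lapl F z k -> lapl G z l ->
  lapl (fun y => F y - G y) z (k - l).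
Proof.
move=> lF lG; have := laplD lF (laplZ (-1) lG); rewrite mulN1r.
by under eq_fun do rewrite mulN1r.
Qed.

Lemma lapl_shift F z x l : lapl F (z + x) l -> lapl (fun y => F (y + x)) z l.
Proof.
move=> [a [b [j1 ->]]]; exists a, b; split => // i.
by under eq_fun do rewrite addrAC.
Qed.

Lemma lapl_min F z l : lapl F z l -> (\forall y \near z, F z <= F y) -> 0 <= l.
Proof.
move=> [a [b [j1 ->]]] Fmin; apply: sumr_ge0 => i _.
apply: jet2_min (j1 i) _; rewrite scale0r addr0; exact: (@cvg_coord_line z i _ Fmin).
Qed.

Lemma nsq_line z i (t : R) : nsq (z + t *: 'e_i) = nsq z + 2 * t * z 0 i + t ^+ 2.
Proof.
rewrite /nsq (bigD1 i) //= [in RHS](bigD1 i) //= !mxE !eqxx /=.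
rewrite (eq_bigr (fun j => z 0 j ^+ 2)); first by ring.
by move=> j /negbTE ji; rewrite !mxE ji /= mulr0 addr0.
Qed.

Lemma jet2_nsq z i : jet2 (fun t : R => nsq (z + t *: 'e_i)) 0 (2 * z 0 i) 2.
Proof.
under eq_fun do rewrite nsq_line expr2.
have jid := jet2_id (0 : R).
have H := jet2D (jet2D (jet2_cst (nsq z) 0) (jet2M (jet2Z 2 jid) (jet2_cst (z 0 i) 0)))
  (jet2M jid jid).
by apply: jet2_eq H _ _; ring.
Qed.

Lemma lapl_radial (F : R -> R) z (c d : R) : jet2 F (nsq z) c d ->
  lapl (fun y => F (nsq y)) z (4 * nsq z * d + 2 * n%:R * c).
Proof.
move=> jF; exists (fun i => c * (2 * z 0 i)), (fun i => d * (2 * z 0 i) ^+ 2 + c * 2).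
split.
  move=> i; apply: (@jet2_comp _ F (fun t : R => nsq (z + t *: 'e_i))).
    exact: jet2_nsq.
  by rewrite scale0r addr0.
rewrite big_split /= sumr_const card_ord -mulr_natr.
rewrite (eq_bigr (fun i => (4 * d) * z 0 i ^+ 2)); last by move=> i _; ring.
by rewrite -mulr_sumr -/(nsq z); ring.
Qed.

Lemma nsq_ge0 z : 0 <= nsq z.
Proof. by apply: sumr_ge0 => i _; exact: sqr_ge0. Qed.

Lemma nsqZ (k : R) z : nsq (k *: z) = k ^+ 2 * nsq z.
Proof. by rewrite /nsq mulr_sumr; apply: eq_bigr => i _; rewrite mxE exprMn. Qed.

(** Kelvin transform of f about the origin, in the sphere of squared radius
    c. *)
Definition kelvin (c : R) f z : R :=
  (c / nsq z) `^ ((n%:R - 2) / 2) * f ((c / nsq z) *: z).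

Lemma sum_delta (G : 'I_n -> R) (j : 'I_n) :
  \sum_i G i * (i == j)%:R = G j.
Proof.
rewrite (bigD1 j) //= eqxx mulr1 big1 ?addr0 // => i /negbTE ->.
by rewrite mulr0.
Qed.

(** The Kelvin transform intertwines the Laplacians up to a power of
    c / |z|^2. Along the i-th coordinate line the conformal factor has
    derivatives A1 i, A2 i, the j-th coordinate of the inverted point has
    derivatives g1 i j, g2 i j, and f at the inverted point has derivatives
    B1 i, B2 i. After summation over i the weight is harmonic, the inversion
    is conformal, and the first order terms cancel. *)
Lemma lapl_kelvin c f z : 0 < c -> 0 < nsq z -> C2_fun f ->
  lapl (kelvin c f) z ((c / nsq z) `^ ((n%:R - 2) / 2 + 2) * laplace f ((c / nsq z) *: z)).
Proof.
move=> c0 r0 Cf; set k := (n%:R - 2) / 2; set r := nsq z in r0 *.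
set q := c / r; have q0 : 0 < q by rewrite divr_gt0.
pose q1 i := - (2 * q / r) * z 0 i.
pose q2 i := - (2 * q / r) + 8 * q / r ^+ 2 * z 0 i ^+ 2.
have rN : r != 0 by rewrite gt_eqF.
have jq i : jet2 (fun t : R => c / nsq (z + t *: 'e_i)) 0 (q1 i) (q2 i).
  have H : jet2 (fun y : R => y^-1) (nsq (z + 0 *: 'e_i)) (- r ^- 2) (2 * r ^- 3).
    by rewrite scale0r addr0; exact: jet2_inv.
  apply: jet2_eq (jet2Z c (jet2_comp (jet2_nsq z i) H)) _ _.
    by rewrite /q1 /q; field.
  by rewrite /q2 /q; field.
pose A1 i := k * q `^ (k - 1) * q1 i.
pose A2 i := k * ((k - 1) * q `^ (k - 2)) * q1 i ^+ 2 + k * q `^ (k - 1) * q2 i.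
have jA i : jet2 (fun t : R => (c / nsq (z + t *: 'e_i)) `^ k) 0 (A1 i) (A2 i).
  have H : jet2 (fun y : R => y `^ k) (c / nsq (z + 0 *: 'e_i))
     (k * q `^ (k - 1)) (k * ((k - 1) * q `^ (k - 2))).
    by rewrite scale0r addr0; exact: jet2_powR.
  by have := jet2_comp (jq i) H.
pose g1 i j := q1 i * z 0 j + q * (i == j)%:R.
pose g2 i j := q2 i * z 0 j + 2 * (q1 i * (i == j)%:R).
have jg i j : jet2 (fun t : R => c / nsq (z + t *: 'e_i) * (z 0 j + t * (i == j)%:R)) 0
   (g1 i j) (g2 i j).
  have jl : jet2 (fun t : R => z 0 j + t * (i == j)%:R) 0 (i == j)%:R 0.
    have := jet2D (jet2_cst (z 0 j) 0) (jet2M (jet2_id (0 : R)) (jet2_cst (i == j)%:R 0)).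
    by move/jet2_eq; apply; ring.
  apply: jet2_eq (jet2M (jq i) jl) _ _.
    by rewrite scale0r addr0 mul0r addr0.
  by rewrite scale0r addr0 mul0r addr0 mulr0 addr0.
have gE i : (fun t : R => f (\row_j (c / nsq (z + t *: 'e_i) * (z 0 j + t * (i == j)%:R))))
    = (fun t : R => f ((c / nsq (z + t *: 'e_i)) *: (z + t *: 'e_i))).
  apply/funext => t; congr (f _); apply/rowP => j; rewrite !mxE.
  by rewrite eqxx /= eq_sym.
set x := q *: z.
have xE i : \row_j (c / nsq (z + 0 *: 'e_i) * (z 0 j + 0 * (i == j)%:R)) = x.
  by apply/rowP => j; rewrite !mxE scale0r addr0 mul0r addr0.
pose d j := 'D_'e_j f x; pose h l j := 'D_'e_l ('D_'e_j f) x.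
pose B1 i := \sum_j g1 i j * d j.
pose B2 i := \sum_j (g2 i j * d j + g1 i j * \sum_l g1 i l * h l j).
have jB i : jet2 (fun t : R => f ((c / nsq (z + t *: 'e_i)) *: (z + t *: 'e_i))) 0
   (B1 i) (B2 i).
  by have := jet2_curve Cf (jg i); rewrite /= gE xE.
exists (fun i => A1 i * f x + q `^ k * B1 i),
  (fun i => A2 i * f x + 2 * (A1 i * B1 i) + q `^ k * B2 i).
split.
  move=> i; apply: jet2_eq (jet2M (jA i) (jB i)) _ _; by rewrite scale0r addr0.
have zz : \sum_i z 0 i ^+ 2 = r by [].
have qk1 : q `^ k = q `^ (k - 2) * q ^+ 2.
  rewrite -powR_mulrn ?ltW // -powRD; last by rewrite (gt_eqF q0) implybT.
  by congr (_ `^ _); ring.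
have qk2 : q `^ (k - 1) = q `^ (k - 2) * q.
  rewrite -{3}(powRr1 (ltW q0)) -powRD; last by rewrite (gt_eqF q0) implybT.
  by congr (_ `^ _); ring.
have qk3 : q `^ (k + 2) = q `^ (k - 2) * q ^+ 4.
  rewrite -powR_mulrn ?ltW // -powRD; last by rewrite (gt_eqF q0) implybT.
  by congr (_ `^ _); ring.
have sA : \sum_i A2 i = 0.
  rewrite /A2 big_split /= -!mulr_sumr.
  rewrite (eq_bigr (fun i => (2 * q / r) ^+ 2 * z 0 i ^+ 2)); last by move=> i _; rewrite /q1; ring.
  rewrite /q2 big_split /= sumr_const card_ord -!mulr_sumr zz qk2 -mulr_natr /k.
  by field.
have sg j l : \sum_i g1 i j * g1 i l = q ^+ 2 * (j == l)%:R.
  rewrite (eq_bigr (fun i => (2 * q / r) ^+ 2 * z 0 j * z 0 l * z 0 i ^+ 2 +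
     (- (2 * q / r) * q * z 0 j * z 0 i) * (i == l)%:R +
     (- (2 * q / r) * q * z 0 l * z 0 i + q ^+ 2 * (i == l)%:R) * (i == j)%:R)); last first.
    by move=> i _; rewrite /g1 /q1; ring.
  rewrite !big_split /= !sum_delta. rewrite -mulr_sumr zz.
  by field.
have sg2 j : \sum_i g2 i j = (4 - 2 * n%:R) * q / r * z 0 j.
  rewrite /g2 big_split /= -mulr_suml /q2 big_split /= sumr_const card_ord.
  rewrite -!mulr_sumr zz sum_delta /q1 -mulr_natr; by field.
have sAg j : \sum_i A1 i * g1 i j = k * q `^ (k - 1) * (2 * q ^+ 2 / r) * z 0 j.
  rewrite (eq_bigr (fun i => k * q `^ (k - 1) * (2 * q / r) ^+ 2 * z 0 j * z 0 i ^+ 2 +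
     (- (k * q `^ (k - 1) * (2 * q / r) * q) * z 0 i) * (i == j)%:R)); last first.
    by move=> i _; rewrite /A1 /g1 /q1; ring.
  rewrite big_split /= sum_delta -mulr_sumr zz; by field.
have sB2 : \sum_i B2 i = \sum_j ((4 - 2 * n%:R) * q / r * z 0 j * d j + q ^+ 2 * h j j).
  rewrite /B2 exchange_big /=; apply: eq_bigr => j _.
  rewrite big_split /= -mulr_suml sg2; congr (_ + _).
  under eq_bigr do rewrite mulr_sumr.
  rewrite exchange_big /= (eq_bigr (fun l => (q ^+ 2 * h l j) * (l == j)%:R)).
    by rewrite sum_delta.
  move=> l _; under eq_bigr do rewrite mulrA.
  by rewrite -mulr_suml sg eq_sym; ring.
have sAB : \sum_i A1 i * B1 i = \sum_j k * q `^ (k - 1) * (2 * q ^+ 2 / r) * z 0 j * d j.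
  rewrite /B1; under eq_bigr do rewrite mulr_sumr.
  rewrite exchange_big /=; apply: eq_bigr => j _.
  by under eq_bigr do rewrite mulrA; rewrite -mulr_suml sAg.
rewrite !big_split /= -mulr_suml sA mul0r add0r -!mulr_sumr sAB sB2.
rewrite [2 * (\sum_j _)]mulr_sumr [q `^ k * (\sum_j _)]mulr_sumr -big_split /= /laplace mulr_sumr; apply: eq_bigr => j _.
rewrite -/(h j j) qk1 qk2 qk3 /k; by field.
Qed.

End laplacian_jets.

(** * Maximum principles *)

Section max_principle.
Set Implicit Arguments.
Unset Strict Implicit.
Variables (R : realType) (n : nat).
Implicit Types (z y p q : 'rV[R]_n).

Lemma nsq_continuous : continuous (@nsq R n).
Proof.
move=> z; change (\sum_i y 0 i ^+ 2 @[y --> nbhs z] --> \sum_i z 0 i ^+ 2).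
by apply: cvg_sum_ord => i; apply: cvgM; exact: coord_continuous.
Qed.

Lemma nsqB_continuous p : continuous (fun y => nsq (y - p)).
Proof.
move=> y; have H : x - p @[x --> nbhs y] --> y - p.
  by apply: cvgB; [exact: cvg_id|exact: cvg_cst].
exact: (cvg_comp _ _ H (@nsq_continuous (y - p))).
Qed.

Lemma coord_sq_le z i : z 0 i ^+ 2 <= nsq z.
Proof.
by rewrite /nsq (bigD1 i) //= lerDl; apply: sumr_ge0 => j _; exact: sqr_ge0.
Qed.

Lemma compact_nsq_annulus p (r1 r2 : R) : compact [set y | r1 <= nsq (y - p) <= r2].
Proof.
apply: bounded_closed_compact.
  exists (`|p| + (1 + `|r2|)); split; first exact: num_real.
  move=> M hM y /= /andP[_ yr]; apply: le_trans (ltW hM).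
  rewrite -[y in leLHS](subrK p) addrC (le_trans (ler_normD _ _)) // lerD2l.
  apply: row_norm_le => [|i]; first by rewrite addr_ge0.
  have := coord_sq_le (y - p) i; rewrite -real_normK ?num_real //.
  have := ler_norm r2; set a := `|(y - p) 0 i|; have : 0 <= (a - 1) ^+ 2 by exact: sqr_ge0.
  have : 0 <= `|r2| by []. have : 0 <= a by rewrite /a.
  by nra.
have -> : [set y | r1 <= nsq (y - p) <= r2] =
   (fun y => nsq (y - p)) @^-1` [set x | r1 <= x <= r2].
  by [].
apply: closed_comp; first by move=> y _; exact: nsqB_continuous.
have -> : [set x : R | r1 <= x <= r2] = `[r1, r2]%classic.
  by apply/seteqP; split => x /=; rewrite in_itv.
exact: interval_closed.
Qed.

Lemma nbhs_nsq_annulus p y (r1 r2 : R) : r1 < nsq (y - p) < r2 ->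
  nbhs y [set y | r1 <= nsq (y - p) <= r2].
Proof.
move=> /andP[h1 h2].
have H1 : \forall x \near y, r1 < nsq (x - p).
  by have := @nsqB_continuous p y => /cvgr_gt; exact.
have H2 : \forall x \near y, nsq (x - p) < r2.
  by have := @nsqB_continuous p y => /cvgr_lt; exact.
near=> x; rewrite /=; apply/andP; split; apply: ltW; near: x; assumption.
Unshelve. all: by end_near. Qed.

(** First contact: among the multiples - mu * g of the barrier that lie
    below the whole family w on K, the highest one touches some member of
    the family. *)
Lemma barrier_contact (m : nat) (K : set 'rV[R]_n) (w : 'I_m -> 'rV[R]_n -> R)
    (g : 'rV[R]_n -> R) (eps : R) (j0 : 'I_m) y0 :
  compact K -> (forall y, K y -> {for y, continuous g}) ->
  (forall j y, K y -> {for y, continuous (w j)}) ->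
  (forall y, K y -> 0 < g y) -> K y0 -> w j0 y0 < - eps * g y0 ->
  exists y j mu, [/\ K y, eps < mu, w j y = - mu * g y &
    forall l x, K x -> - mu * g x <= w l x].
Proof.
move=> cK cg cw g0 Ky0 hw.
have K0 : K !=set0 by exists y0.
have H j : exists y, K y /\ forall x, K x -> w j y / g y <= w j x / g x.
  have [|c cK' Hc] := @EVT_min_rV R n (fun y => w j y / g y) K K0 cK.
    apply: continuous_in_subspaceT => y /set_mem Ky.
    have cq : {for y, continuous (fun y => w j y / g y)}; last exact: cq.
    apply: continuousM; first exact: cw.
    by apply: continuousV; [rewrite gt_eqF // g0|exact: cg].
  by exists c; split; [exact: set_mem|move=> x Kx; apply: Hc; exact: mem_set].
have [yy Hy] := fin_all_exists H.
pose v j := w j (yy j) / g (yy j).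
have [i _ Hi] := @arg_minP _ _ _ j0 xpredT v isT.
have gy j : 0 < g (yy j) by apply: g0; case: (Hy j).
exists (yy i), i, (- v i); split.
- by case: (Hy i).
- rewrite ltrNr; apply: le_lt_trans (Hi j0 isT) _.
  apply: le_lt_trans ((Hy j0).2 _ Ky0) _.
  by rewrite ltr_pdivrMr ?g0.
- by rewrite opprK /v divfK // gt_eqF.
- move=> l x Kx; rewrite opprK -ler_pdivlMr ?g0 //.
  by apply: le_trans (Hi l isT) _; exact: (Hy l).2.
Qed.

(** Maximum principle for a finite family of functions. The hypothesis is
    only tested at a point where - mu * g touches a member of the family
    from below. *)
Lemma max_principle (m : nat) (K : set 'rV[R]_n) (w : 'I_m -> 'rV[R]_n -> R)
    (g : 'rV[R]_n -> R) (eps : R) :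
  compact K -> (forall y, K y -> {for y, continuous g}) ->
  (forall j y, K y -> {for y, continuous (w j)}) ->
  (forall y, K y -> 0 < g y) ->
  (forall y j mu, K y -> eps < mu -> w j y = - mu * g y ->
     (forall l, - mu * g y <= w l y) ->
     nbhs y K /\
     exists lw lg, [/\ lapl (w j) y lw, lapl g y lg & lw + mu * lg < 0]) ->
  forall j y, K y -> - eps * g y <= w j y.
Proof.
move=> cK cg cw g0 H j y Ky; rewrite leNgt; apply/negP => hw.
have [x [i [mu [Kx emu wx Hx]]]] := barrier_contact cK cg cw g0 Ky hw.
have [nK [lw [lg [l1 l2 neg]]]] := H x i mu Kx emu wx (fun l => Hx l x Kx).
have L := laplD l1 (laplZ mu l2).
move: neg; rewrite ltNge => /negP; apply; apply: (lapl_min L).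
near=> s; have Ks : K s by near: s.
rewrite wx mulNr addNr -lerBlDr sub0r -mulNr; exact: Hx.
Unshelve. all: by end_near. Qed.

(** Powers of the squared distance to the origin; the result vanishes for
    a = (2 - n)/2. *)
Lemma lapl_powR (a : R) z : 0 < nsq z ->
  lapl (fun y => nsq y `^ a) z
    (2 * a * (2 * a + n%:R - 2) * nsq z `^ (a - 1)).
Proof.
move=> z0; have := lapl_radial (jet2_powR a z0).
rewrite (_ : nsq z `^ (a - 1) = nsq z * nsq z `^ (a - 2)).
  by congr lapl; ring.
rewrite -{2}(powRr1 (nsq_ge0 z)) -powRD ?(gt_eqF z0) ?implybT //.
by congr (_ `^ _); ring.
Qed.

Lemma lapl_cst (c : R) z : lapl (fun=> c) z 0.
Proof.
by exists (fun=> 0), (fun=> 0); split; [move=> i; exact: jet2_cst|rewrite big1].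
Qed.

(** Nonnegative superharmonic functions, at a point. *)
Definition supersol (w : 'rV[R]_n -> R) y :=
  [/\ {for y, continuous w}, 0 <= w y & exists2 l, l <= 0 & lapl w y l].

Lemma lapl_powR_shift (a : R) p z : 0 < nsq (z - p) ->
  lapl (fun y => nsq (y - p) `^ a) z
    (2 * a * (2 * a + n%:R - 2) * nsq (z - p) `^ (a - 1)).
Proof.
by move=> h; have := @lapl_shift R n (fun y => nsq y `^ a) z (- p) _ (lapl_powR a h).
Qed.

Lemma powR_nsq_cont (a : R) p z : 0 < nsq (z - p) ->
  {for z, continuous (fun y => nsq (y - p) `^ a)}.
Proof.
move=> h.
apply: (@cvg_comp _ _ _ (fun y => nsq (y - p)) (fun r => r `^ a) _ (nbhs (nsq (z - p)))).
  exact: nsqB_continuous.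
exact: (jet2_cvg (jet2_powR a h)).
Qed.

(** Strong maximum principle on a ball centred at a point of positivity. The
    barrier on an annulus around p is a multiple of the strictly subharmonic
    function |y-p|^(-2n), shifted so as to vanish on the outer sphere. *)
Lemma strong_max_ball (w : 'rV[R]_n -> R) p q (T : R) : (0 < n)%N ->
  (forall y, nsq (y - p) < T -> supersol w y) -> 0 < w p -> nsq (q - p) < T ->
  0 < w q.
Proof.
move=> n0 Hw wp qT.
have T0 : 0 < T by exact: le_lt_trans (nsq_ge0 _) qT.
have npp : nsq (p - p) = 0 by rewrite subrr /nsq big1 // => i _; rewrite mxE expr0n.
have [s s0 [sT Hs]] : exists2 s, 0 < s & s < T /\ forall y, nsq (y - p) <= s -> w p / 2 <= w y.
  have [|cp _ _] := Hw p; first by rewrite npp.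
  have : \forall y \near p, w p / 2 <= w y.
    have /cvgr_gt/(_ (w p / 2)) : w y @[y --> p] --> w p by exact: cp.
    rewrite ltr_pdivrMr // ltr_pMr // ltr1n => /(_ isT).
    by apply: filterS => y; exact: ltW.
  move=> /nbhs_ballP[e /= e0 He].
  exists (Num.min (T / 2) ((e / 2) ^+ 2)).
    by rewrite lt_min !divr_gt0 //= exprn_gt0 // divr_gt0.
  split; first by rewrite gt_min ltr_pdivrMr // ltr_pMr // ltr1n.
  move=> y ys; apply: He; rewrite -ball_normE /= distrC.
  have e20 : 0 < e / 2 by rewrite divr_gt0.
  apply: (@le_lt_trans _ _ (e / 2)); last by rewrite ltr_pdivrMr // ltr_pMr // ltr1n.
  apply: row_norm_le => [|i]; first exact: ltW.
  rewrite -(@ler_pXn2r _ 2) ?nnegrE // ?(ltW e20) // real_normK ?num_real //.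
  apply: le_trans (coord_sq_le _ _) (le_trans ys _).
  by rewrite ge_min lexx orbT.
have [qs|qs] := leP (nsq (q - p)) s; first by apply: lt_le_trans (Hs _ qs); rewrite divr_gt0.
pose T' := (nsq (q - p) + T) / 2.
have qT' : nsq (q - p) < T' by rewrite /T'; lra.
have T'T : T' < T by rewrite /T'; lra.
have T'0 : 0 < T' by apply: le_lt_trans qT'; exact: nsq_ge0.
pose a : R := - n%:R.
pose k := (w p / 2) / s `^ a.
have k0 : 0 < k by rewrite !divr_gt0 // powR_gt0.
pose b y := k * (nsq (y - p) `^ a - T' `^ a).
have aneg : a < 0 by rewrite /a oppr_lt0 ltr0n.
have mono (x y : R) : 0 < x -> x < y -> y `^ a < x `^ a.
  move=> x0 xy; have y0 := lt_trans x0 xy.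
  rewrite /a !powRN ltf_pV2 ?posrE ?powR_gt0 //.
  by rewrite gt0_ltr_powR ?ltr0n // nnegrE ltW.
pose K := [set y | s <= nsq (y - p) <= T'].
have Kpos : forall x, K x -> 0 < nsq (x - p) by move=> v; rewrite /K /= => /andP[h _]; exact: lt_le_trans h.
have KT : forall x, K x -> nsq (x - p) < T by move=> v; rewrite /K /= => /andP[_ h]; exact: le_lt_trans T'T.
have := @max_principle 1 K (fun _ y => w y - b y) (fun=> 1) 0 (@compact_nsq_annulus p s T').
have c1 y : K y -> {for y, continuous (fun _ : 'rV[R]_n => 1 : R)} by move=> _; exact: cst_continuous.
have c2 (j : 'I_1) y : K y -> {for y, continuous (fun y => w y - b y)}.
  move=> Ky; have [cw _ _] := Hw y (KT y Ky).
  apply: continuousB; first exact: cw.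
  apply: continuousM; first exact: cst_continuous.
  apply: continuousB; last exact: cst_continuous.
  exact: powR_nsq_cont (Kpos y Ky).
move=> /(_ c1 c2 (fun _ _ => ltr01)) MP.
suff : 0 <= w q - b q.
  move=> h; have : 0 < b q by rewrite /b mulr_gt0 // subr_gt0 mono // (lt_trans s0 qs).
  by lra.
rewrite -[X in X <= _](_ : - 0 * 1 = 0); last by rewrite oppr0 mul0r.
apply: (MP _ ord0 q); last by rewrite /K /= !ltW.
move=> y _ mu Ky mu0 wy _; rewrite mulr1 in wy.
have yT := KT y Ky; have y0 := Kpos y Ky.
have [_ w0 [l l0 lw]] := Hw y yT.
split.
  apply: nbhs_nsq_annulus; move: (Ky) => /andP[]; rewrite !le_eqVlt.
  move=> /orP[/eqP sy|->] /orP[/eqP yT'|->] //.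
  - by move: qs qT'; rewrite sy yT' => /lt_trans h /h; rewrite ltxx.
  - have := Hs y; rewrite -sy lexx => /(_ isT) h.
    have : b y <= w p / 2.
      rewrite /b -sy /k mulrBr divfK; last by rewrite gt_eqF // powR_gt0.
      by rewrite gerBl mulr_ge0 ?powR_ge0 // ltW.
    by lra.
  - have : b y = 0 by rewrite /b yT' subrr mulr0.
    by lra.
exists (l - k * (2 * a * (2 * a + n%:R - 2) * nsq (y - p) `^ (a - 1) - 0)), 0; split.
- by apply: laplB lw _; apply: laplZ; apply: laplB (lapl_cst _ _); exact: lapl_powR_shift.
- exact: lapl_cst.
- rewrite mulr0 addr0 subr0 subr_lt0; apply: le_lt_trans l0 _.
  rewrite pmulr_rgt0 // mulr_gt0 ?powR_gt0 //.
  rewrite nmulr_rgt0 /a ?mulrN ?oppr_lt0 ?mulr_gt0 ?ltr0n //.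
  have : (0 : R) <= n%:R by []. by lra.
Qed.

(** The Euclidean scalar product. *)
Definition dot z y : R := \sum_i z 0 i * y 0 i.

Lemma nsqD z y : nsq (z + y) = nsq z + 2 * dot z y + nsq y.
Proof.
rewrite /nsq /dot mulr_sumr -!big_split /=; apply: eq_bigr => i _.
by rewrite mxE; ring.
Qed.

Lemma dotZl (k : R) z y : dot (k *: z) y = k * dot z y.
Proof. by rewrite /dot mulr_sumr; apply: eq_bigr => i _; rewrite mxE mulrA. Qed.

Lemma dotZr (k : R) z y : dot z (k *: y) = k * dot z y.
Proof. by rewrite /dot mulr_sumr; apply: eq_bigr => i _; rewrite mxE mulrCA. Qed.

Lemma dotC z y : dot z y = dot y z.
Proof. by apply: eq_bigr => i _; rewrite mulrC. Qed.

Lemma nsqN z : nsq (- z) = nsq z.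
Proof. by apply: eq_bigr => i _; rewrite mxE sqrrN. Qed.

(** Weighted triangle inequality for squares. *)
Lemma nsqD_le z y (t : R) : 0 < t ->
  nsq (z + y) <= (1 + t) * nsq z + (1 + t^-1) * nsq y.
Proof.
move=> t0; rewrite /nsq !mulr_sumr -big_split /=; apply: ler_sum => i _.
rewrite mxE -subr_ge0.
rewrite (_ : _ - _ = (t * z 0 i - y 0 i) ^+ 2 / t); first by rewrite divr_ge0 ?sqr_ge0 // ltW.
by field; rewrite gt_eqF.
Qed.

(** Propagation of positivity along a segment that stays away from the ball
    |y|^2 <= c, by a chain of balls of a fixed radius. *)
Lemma strong_max_segment (w : 'rV[R]_n -> R) p q (c c' : R) : (0 < n)%N ->
  0 < c -> c < c' -> (forall y, c < nsq y -> supersol w y) ->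
  (forall t : R, 0 <= t <= 1 -> c' <= nsq (p + t *: (q - p))) -> 0 < w p -> 0 < w q.
Proof.
move=> n0 c0 cc Hw Hpq wp.
(* weight for nsqD_le such that (1 + th) * c is the midpoint of c and c' *)
pose th := (c' - c) / (2 * c).
have th0 : 0 < th by rewrite divr_gt0 ?subr_gt0 // mulr_gt0.
pose d := (c' - c) / 2 / (1 + th^-1).
have d0 : 0 < d by rewrite !divr_gt0 ?subr_gt0 // addr_gt0 // invr_gt0.
have far x y : c' <= nsq x -> nsq (y - x) < d -> c < nsq y.
  move=> hx hd; rewrite ltNge; apply/negP => hy.
  have := nsqD_le y (x - y) th0; rewrite addrC subrK -(nsqN (x - y)) opprB.
  have i1 : (1 + th^-1) * nsq (y - x) < (c' - c) / 2.
    by rewrite mulrC -ltr_pdivlMr // addr_gt0 // invr_gt0.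
  have i2 : (1 + th) * nsq y <= (1 + th) * c by rewrite ler_wpM2l // addr_ge0 // ltW.
  have i3 : (1 + th) * c = (c + c') / 2 by rewrite /th; field; rewrite gt_eqF.
  by lra.
(* with N.+1 steps the squared step length nsq (q - p) / N.+1 ^ 2 is less than d *)
pose N := Num.truncn (nsq (q - p) / d).
have Nd : nsq (q - p) < N.+1%:R * d.
  by rewrite -ltr_pdivrMr // /N; apply: truncnS_gt.
have NN : 0 < N.+1%:R :> R by rewrite ltr0n.
have step (k : nat) : (k <= N.+1)%N -> 0 < w (p + (k%:R / N.+1%:R) *: (q - p)).
  elim: k => [|k IH] kN; first by rewrite mul0r scale0r addr0.
  have Ik := IH (ltnW kN).
  apply: (@strong_max_ball w _ _ d n0 _ Ik).
    move=> y hy; apply: Hw; apply: far hy; apply: Hpq.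
    by rewrite divr_ge0 //= ler_pdivrMr // mul1r ler_nat ltnW.
  rewrite opprD addrACA subrr add0r -scalerBl nsqZ.
  rewrite (_ : _ - _ = N.+1%:R^-1); last by rewrite -natr1; field; rewrite gt_eqF.
  rewrite exprVn mulrC ltr_pdivrMr ?exprn_gt0 //; apply: lt_le_trans Nd _.
  rewrite mulrC ler_wpM2l // ?(ltW d0) // expr2 ler_peMl // ?ler1n // ltW //.
by have := step N.+1 (leqnn _); rewrite divff ?gt_eqF // scale1r addrC subrK.
Qed.

(** Two exterior points at an angle of at most 90 degrees are joined by the
    broken line through their doubles. *)
Lemma strong_max_link (w : 'rV[R]_n -> R) p q (c : R) : (0 < n)%N ->
  0 < c -> (forall y, c < nsq y -> supersol w y) ->
  c < nsq p -> c < nsq q -> 0 <= dot p q -> 0 < w p -> 0 < w q.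
Proof.
move=> n0 c0 Hw hp hq pq wp.
have w2p : 0 < w (2 *: p).
  apply: (@strong_max_segment w p (2 *: p) c (nsq p) n0 c0 hp Hw) wp => t /andP[t0 t1].
  rewrite (_ : _ + _ = (1 + t) *: p); last first.
    by apply/rowP => i; rewrite !mxE; ring.
  have := nsq_ge0 p; rewrite nsqZ; nra.
have w2q : 0 < w (2 *: q).
  apply: (@strong_max_segment w (2 *: p) (2 *: q) c (2 * c) n0 c0 _ Hw _ w2p).
    by lra.
  move=> t /andP[t0 t1].
  rewrite (_ : _ + _ = (2 * (1 - t)) *: p + (2 * t) *: q); last first.
    by apply/rowP => i; rewrite !mxE; ring.
  rewrite nsqD dotZl dotZr !nsqZ.
  have h1 : 0 <= 2 * (2 * (1 - t) * (2 * t * dot p q)).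
    by rewrite !mulr_ge0 // subr_ge0.
  have h2 : (2 * (1 - t)) ^+ 2 * c <= (2 * (1 - t)) ^+ 2 * nsq p.
    by rewrite ler_wpM2l ?sqr_ge0 // ltW.
  have h3 : (2 * t) ^+ 2 * c <= (2 * t) ^+ 2 * nsq q.
    by rewrite ler_wpM2l ?sqr_ge0 // ltW.
  have h4 : 0 <= (2 * t - 1) ^+ 2 * c by rewrite mulr_ge0 ?sqr_ge0 // ltW.
  by nra.
apply: (@strong_max_segment w (2 *: q) q c (nsq q) n0 c0 hq Hw) w2q => t /andP[t0 t1].
rewrite (_ : _ + _ = (2 - t) *: q); last first.
  by apply/rowP => i; rewrite !mxE; ring.
have h : 0 <= (1 - t) * (3 - t) * nsq q.
  by rewrite !mulr_ge0 ?nsq_ge0 // subr_ge0 // (le_trans t1) // ler1n.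
by rewrite nsqZ; lra.
Qed.

Lemma dot_delta p (k : R) i : dot p (k *: delta_mx 0 i) = k * p 0 i.
Proof.
rewrite dotZr /dot (bigD1 i) //= mxE !eqxx mulr1 big1 ?addr0 // => j /negbTE ji.
by rewrite mxE ji andbF mulr0.
Qed.

Lemma nsq_delta (k : R) (i : 'I_n) : nsq (k *: delta_mx 0 i : 'rV[R]_n) = k ^+ 2.
Proof.
rewrite nsqZ /nsq (bigD1 i) //= mxE !eqxx expr1n big1 ?addr0 ?mulr1 // => j /negbTE ji.
by rewrite mxE ji andbF expr0n.
Qed.

(** Strong maximum principle outside a ball. As n > 1, two exterior points
    are linked through suitable multiples of the first two coordinate
    vectors. *)
Lemma strong_max_exterior (w : 'rV[R]_n -> R) p q (c : R) : (1 < n)%N ->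
  0 < c -> (forall y, c < nsq y -> supersol w y) ->
  c < nsq p -> c < nsq q -> 0 < w p -> 0 < w q.
Proof.
move=> n1 c0 Hw hp hq wp; have n0 : (0 < n)%N := ltnW n1.
(* M s has the sign of s, and its square exceeds c *)
pose M (s : R) := (if 0 <= s then 1 else -1) * (c + 1).
have Ms s : 0 <= M s * s.
  rewrite /M; case: (leP 0 s) => s0; first by rewrite mul1r mulr_ge0 // addr_ge0 // ltW.
  by rewrite mulN1r mulNr -mulrN mulr_ge0 ?addr_ge0 ?oppr_ge0 // ltW.
have M2 s : c < M s ^+ 2.
  rewrite /M exprMn (_ : (if _ then _ else _) ^+ 2 = 1); last by case: ifP => _; rewrite ?sqrrN expr1n.
  by rewrite mul1r sqrrD expr1n mulr1; have := sqr_ge0 c; lra.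
pose i0 := Ordinal n0; pose i1 := Ordinal n1.
(* p, M e_0, M' e_1, q: consecutive vectors have nonnegative scalar product *)
have step1 : 0 < w (M (p 0 i0) *: delta_mx 0 i0).
  apply: (@strong_max_link w p _ c n0 c0 Hw hp) wp; first by rewrite nsq_delta.
  by rewrite dot_delta.
have step2 : 0 < w (M (q 0 i1) *: delta_mx 0 i1).
  apply: (@strong_max_link w _ _ c n0 c0 Hw) step1; rewrite ?nsq_delta //.
  by rewrite dot_delta !mxE /= !mulr0.
apply: (@strong_max_link w _ _ c n0 c0 Hw _ hq _ step2); first by rewrite nsq_delta.
by rewrite dotC dot_delta.
Qed.

End max_principle.

(** * The Euclidean norm and the power nonlinearity *)

Section enorm_facts.
Set Implicit Arguments.
Unset Strict Implicit.
Variables (R : realType) (m : nat).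
Implicit Types (a b : 'rV[R]_m).

Lemma enorm_nsq a : enorm a = Num.sqrt (nsq a). Proof. by []. Qed.

Lemma enorm_ge0 a : 0 <= enorm a. Proof. exact: sqrtr_ge0. Qed.

Lemma enorm_sqr a : enorm a ^+ 2 = nsq a.
Proof. by rewrite sqr_sqrtr // nsq_ge0. Qed.

Lemma enormZ (k : R) a : 0 <= k -> enorm (k *: a) = k * enorm a.
Proof. by move=> k0; rewrite enorm_nsq nsqZ sqrtrM ?sqr_ge0 // sqrtr_sqr ger0_norm. Qed.

Lemma coord_le_enorm a i : a 0 i <= enorm a.
Proof.
apply: le_trans (ler_norm _) _.
rewrite -(@ler_pXn2r _ 2) ?nnegrE ?enorm_ge0 // real_normK ?num_real //.
by rewrite enorm_sqr coord_sq_le.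
Qed.

Lemma ler_enorm a b : nonneg_vec a -> (forall i, a 0 i <= b 0 i) -> enorm a <= enorm b.
Proof.
move=> a0 ab; rewrite ler_wsqrtr //; apply: ler_sum => i _.
by rewrite ler_pXn2r ?nnegrE // ?(le_trans (a0 i)).
Qed.

Lemma enorm_eq a b : nonneg_vec a -> (forall i, a 0 i <= b 0 i) ->
  enorm a = enorm b -> a = b.
Proof.
move=> a0 ab /(congr1 (fun x => x ^+ 2)); rewrite !enorm_sqr => E.
have H : \sum_i (b 0 i ^+ 2 - a 0 i ^+ 2) = 0 by rewrite sumrB -/(nsq a) -/(nsq b) E subrr.
have b0 i : 0 <= b 0 i by apply: le_trans (ab i); exact: a0.
have H0 i : true -> 0 <= b 0 i ^+ 2 - a 0 i ^+ 2.
  by move=> _; rewrite subr_ge0 ler_pXn2r ?nnegrE // a0.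
apply/rowP => i; move/eqP: H; rewrite psumr_eq0 // => /allP/(_ i (mem_index_enum _)).
by rewrite subr_eq0 /= eqrXn2 // ?a0 // => /eqP ->.
Qed.

(** The constant m is not optimal (the square root of m would do), but it is
    elementary. *)
Lemma enorm_shift_le a b (t : R) : nonneg_vec a -> nonneg_vec b -> 0 <= t ->
  (forall i, b 0 i - t <= a 0 i) -> enorm b <= enorm a + m%:R * t.
Proof.
move=> a0 b0 t0 ab; rewrite -(@ler_pXn2r _ 2) ?nnegrE ?addr_ge0 ?mulr_ge0 ?enorm_ge0 //.
rewrite enorm_sqr; apply: (@le_trans _ _ (\sum_i (a 0 i ^+ 2 + (2 * t * enorm a + t ^+ 2)))).
  apply: ler_sum => i _.
  have h1 : b 0 i ^+ 2 <= (a 0 i + t) ^+ 2.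
    by rewrite ler_pXn2r ?nnegrE ?addr_ge0 ?b0 ?a0 // -lerBlDr.
  have := coord_le_enorm a i.
  have : 0 <= t * (enorm a - a 0 i) by rewrite mulr_ge0 // subr_ge0 coord_le_enorm.
  by nra.
rewrite big_split /= -/(nsq a) -enorm_sqr sumr_const card_ord -mulr_natr.
have h2 : (m%:R : R) <= m%:R ^+ 2 by rewrite -natrX ler_nat; case: m => // k; rewrite expnS leq_pmulr.
have h3 : 0 <= (m%:R ^+ 2 - m%:R) * t ^+ 2 by rewrite mulr_ge0 ?sqr_ge0 // subr_ge0.
by nra.
Qed.

(** One-sided Lipschitz estimate for the cooperative nonlinearity |a|^p a:
    if no component of a is below that of b by more than t, and the i-th one
    is so by exactly t, then the i-th component of the nonlinearity drops by
    at most a multiple of t |b|^p. *)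
Lemma power_nonlinearity_le (p : R) a b (t : R) i : 0 <= p <= 4 ->
  nonneg_vec a -> nonneg_vec b -> 0 <= t ->
  (forall j, b 0 j - t <= a 0 j) -> a 0 i = b 0 i - t ->
  enorm b `^ p * b 0 i - enorm a `^ p * a 0 i <= (1 + 4 * m%:R) * t * enorm b `^ p.
Proof.
move=> /andP[p0 p4] a0 b0 t0 ab ai.
set A := enorm a; set B := enorm b.
have A0 : 0 <= A by exact: enorm_ge0.
have B0 : 0 <= B by exact: enorm_ge0.
have AB : B <= A + m%:R * t by exact: enorm_shift_le.
have bB : b 0 i <= B by exact: coord_le_enorm.
have bi0 := b0 i; have ai0 := a0 i.
have Ap : 0 <= A `^ p by exact: powR_ge0.
have Bp : 0 <= B `^ p by exact: powR_ge0.
have m0 : 0 <= m%:R :> R by [].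
have mt : 0 <= m%:R * t by rewrite mulr_ge0.
have [Bs|Bs] := leP B (m%:R * t).
  have h1 : B `^ p * b 0 i <= B `^ p * (m%:R * t) by rewrite ler_wpM2l // (le_trans bB).
  have h2 : 0 <= A `^ p * a 0 i by rewrite mulr_ge0.
  have h3 : 0 <= B `^ p * (m%:R * t) by rewrite mulr_ge0.
  have h4 : 0 <= B `^ p * t by rewrite mulr_ge0.
  by nra.
have Bpos : 0 < B by exact: le_lt_trans Bs.
pose s := m%:R * t / B.
have sB : s * B = m%:R * t by rewrite /s divfK // gt_eqF.
have s0 : 0 <= s by rewrite divr_ge0.
have s1 : s < 1 by rewrite ltr_pdivrMr // mul1r.
have s1' : 0 <= 1 - s by rewrite subr_ge0 ltW.
have h1 : B `^ p * (1 - 4 * s) <= A `^ p.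
  apply: (@le_trans _ _ (B `^ p * (1 - s) `^ p)); last first.
    rewrite -powRM //; apply: (ge0_ler_powR p0); rewrite ?nnegrE ?mulr_ge0 //.
    by rewrite mulrBr mulr1 mulrC sB lerBlDr.
  rewrite ler_wpM2l //; apply: (@le_trans _ _ ((1 - s) ^+ 4)).
    have h : 0 <= s ^+ 2 * (s ^+ 2 - 4 * s + 6) by rewrite mulr_ge0 ?sqr_ge0 //; nra.
    by rewrite -subr_ge0 (_ : _ - _ = s ^+ 2 * (s ^+ 2 - 4 * s + 6)) //; ring.
  rewrite -powR_mulrn //; apply: ger_powR => //.
  by rewrite subr_gt0 s1 /= gerBl.
have h2 : B `^ p * (1 - 4 * s) * a 0 i <= A `^ p * a 0 i by rewrite ler_wpM2r.
have h3 : s * a 0 i <= m%:R * t.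
  by rewrite -sB ler_wpM2l // (le_trans _ bB) // ai gerBl.
have h4 : B `^ p * (s * a 0 i) <= B `^ p * (m%:R * t) by rewrite ler_wpM2l.
have E : B `^ p * (1 - 4 * s) * a 0 i = B `^ p * b 0 i - B `^ p * t - 4 * (B `^ p * (s * a 0 i)).
  by rewrite {1}ai (_ : s * a 0 i = s * (b 0 i - t)) ?ai //; ring.
by nra.
Qed.

End enorm_facts.

(** * Comparison of a solution with its Kelvin transform *)

Section moving_spheres.
Set Implicit Arguments.
Unset Strict Implicit.
Variables (R : realType) (n m : nat) (p : R).
Implicit Types (u : 'rV[R]_n -> 'rV[R]_m) (z y : 'rV[R]_n) (c : R).

(** The i-th component of a vector valued function. *)
Definition component u (i : 'I_m) : 'rV[R]_n -> R := fun x => u x 0 i.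

(** Twice differentiable nonnegative entire solutions of the system with
    exponent p + 1, stated componentwise. *)
Definition solution u := [/\ forall i, C2_fun (component u i),
  forall x, nonneg_vec (u x) &
  forall i x, - laplace (component u i) x = enorm (u x) `^ p * u x 0 i].

(** Kelvin transform of a vector valued function; the weight exponent is the
    same for all components. *)
Definition kelvin_vec c u z : 'rV[R]_m :=
  (c / nsq z) `^ ((n%:R - 2) / 2) *: u ((c / nsq z) *: z).

(** Outside the sphere of squared radius c, the Kelvin transform of u is at
    most u. *)
Definition kelvin_le c u := forall z j, c <= nsq z -> kelvin c (component u j) z <= component u j z.

(** The difference of a component of u and of its Kelvin transform. *)
Definition kelvin_gap c u j z := component u j z - kelvin c (component u j) z.

Local Notation k := ((n%:R - 2) / 2 : R).

Lemma kelvin_vecE c u z j : kelvin_vec c u z 0 j = kelvin c (component u j) z.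
Proof. by rewrite mxE. Qed.

Lemma kelvin_vec_ge0 c u z : solution u -> nonneg_vec (kelvin_vec c u z).
Proof. by move=> [_ u0 _] j; rewrite mxE mulr_ge0 ?powR_ge0 // u0. Qed.

Lemma sol_cont u j : solution u -> continuous (component u j).
Proof. by move=> [/(_ j) [d _] _ _] x; exact: differentiable_continuous. Qed.

Lemma enorm_kelvin_vec_powR c u z :
  enorm (kelvin_vec c u z) `^ p =
  (c / nsq z) `^ (k * p) * enorm (u ((c / nsq z) *: z)) `^ p.
Proof.
rewrite /kelvin_vec; set q := c / nsq z.
rewrite enormZ; last exact: powR_ge0.
rewrite (powRM _ (powR_ge0 _ _) (enorm_ge0 _)).
by rewrite powRrM.
Qed.

(** The transform of a solution solves the same equation with the extra
    factor (c / |z|^2)^(2 - k p), which is at most 1 outside the sphere. *)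
Lemma lapl_kelvin_gap u c z i : solution u -> 0 < c -> 0 < nsq z ->
  lapl (kelvin_gap c u i) z
    ((c / nsq z) `^ (2 - k * p) * (enorm (kelvin_vec c u z) `^ p * kelvin_vec c u z 0 i)
      - enorm (u z) `^ p * u z 0 i).
Proof.
move=> [Cu u0 eq] c0 z0.
have q0 : 0 < c / nsq z by rewrite divr_gt0.
have := laplB (lapl_C2 z (Cu i)) (lapl_kelvin c0 z0 (Cu i)).
have E x : laplace (component u i) x = - (enorm (u x) `^ p * u x 0 i) by rewrite -eq opprK.
rewrite !E; set q := c / nsq z in q0 *; congr lapl.
rewrite mulrN opprK addrC; congr (_ - _).
rewrite enorm_kelvin_vec_powR -/q mxE -/q; set N := enorm _ `^ p.
transitivity ((q `^ (2 - k * p) * q `^ (k * p) * q `^ k) * (N * u (q *: z) 0 i)); last by ring.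
rewrite -!powRD ?(gt_eqF q0) ?implybT //; congr (_ `^ _ * _); by ring.
Qed.

(** The constant of power_nonlinearity_le. *)
Definition coupling : R := 1 + 4 * m%:R.

Lemma kelvin_gap_cont u c j z : solution u -> 0 < nsq z ->
  0 < c -> {for z, continuous (kelvin_gap c u j)}.
Proof.
move=> su z0 c0; apply: continuousB; first exact: sol_cont.
have cq : {for z, continuous (fun y => c / nsq y)}.
  apply: continuousM; first exact: cst_continuous.
  by apply: continuousV; [rewrite gt_eqF|exact: nsq_continuous].
apply: continuousM.
  have jq := jet2_powR k (divr_gt0 c0 z0).
  exact: (cvg_comp _ _ cq (jet2_cvg jq)).
have cz : {for z, continuous (fun y : 'rV[R]_n => (c / nsq y) *: y)}.
  by apply: continuousZ => //; exact: cvg_id.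
exact: (cvg_comp _ _ cz (@sol_cont u j su _)).
Qed.

Hypothesis p0 : 0 < p.
Hypothesis p4 : p <= 4.
Hypothesis kp2 : k * p <= 2.
Hypothesis n3 : (3 <= n)%N.

(** At a point where the i-th difference is the lowest one, with value - t,
    its Laplacian is at most a constant times t; the potential in front of t
    decays like |z|^(-4). *)
Lemma lapl_kelvin_gap_le u c z i (t : R) : solution u -> 0 < c -> c <= nsq z -> 0 <= t ->
  kelvin_gap c u i z = - t -> (forall l, - t <= kelvin_gap c u l z) ->
  exists2 l, l <= coupling * t * ((c / nsq z) ^+ 2 * enorm (u ((c / nsq z) *: z)) `^ p) &
     lapl (kelvin_gap c u i) z l.
Proof.
move=> su c0 cz t0 wi wl; have z0 : 0 < nsq z by exact: lt_le_trans cz.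
eexists; last exact: lapl_kelvin_gap.
have [_ u0 _] := su.
have b0 := kelvin_vec_ge0 c z su.
have q0 : 0 < c / nsq z by rewrite divr_gt0.
have q1 : c / nsq z <= 1 by rewrite ler_pdivrMr // mul1r.
have P : 0 <= p <= 4 by rewrite ltW.
have H := @power_nonlinearity_le R m p (u z) (kelvin_vec c u z) t i P (u0 z) b0 t0.
have {H} := H _ _; rewrite -/coupling => H.
set th := _ `^ (2 - _); set X := _ * kelvin_vec c u z 0 i; set Y := _ * u z 0 i.
have th0 : 0 <= th by exact: powR_ge0.
have th1 : th <= 1.
  have e0 : 0 <= 2 - k * p by rewrite subr_ge0.
  have := ge0_ler_powR e0 (ltW q0 : c / nsq z \in Num.nneg) (ler01 : (1 : R) \in Num.nneg) q1.
  by rewrite powR1.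
have Y0 : 0 <= Y by rewrite mulr_ge0 ?powR_ge0 // u0.
have XY : X - Y <= coupling * t * enorm (kelvin_vec c u z) `^ p.
  apply: H => [j|]; rewrite kelvin_vecE.
    by have := wl j; rewrite /kelvin_gap /component; lra.
  by have := wi; rewrite /kelvin_gap /component; lra.
apply: (@le_trans _ _ (th * (X - Y))).
  have : 0 <= (1 - th) * Y by rewrite mulr_ge0 // subr_ge0.
  by lra.
apply: (@le_trans _ _ (th * (coupling * t * enorm (kelvin_vec c u z) `^ p))).
  by rewrite ler_wpM2l.
have C0 : 0 <= coupling * t.
  by apply: mulr_ge0 => //; apply: addr_ge0 => //; exact: mulr_ge0.
rewrite mulrCA; apply: (ler_wpM2l C0).
rewrite enorm_kelvin_vec_powR /th; move: (c / nsq z) q0 => q q0.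
rewrite mulrA -powRD; last by rewrite (gt_eqF q0) implybT.
by rewrite subrK powR_mulrn // ltW.
Qed.

Lemma kelvin_sphere f c z : 0 < c -> nsq z = c -> kelvin c f z = f z :> R.
Proof. by move=> c0 zc; rewrite /kelvin zc divff ?gt_eqF // powR1 mul1r scale1r. Qed.

(** Comparison principle on an annulus outside the sphere, for a barrier g
    with Laplacian lg that is a strict supersolution of the linearised
    inequality. *)
Lemma system_comparison u c r1 r2 (g lg : 'rV[R]_n -> R) eps :
  solution u -> 0 < c -> c <= r1 -> 0 <= eps ->
  let K := [set y | r1 <= nsq y <= r2] in
  (forall y, K y -> 0 < g y) -> (forall y, K y -> {for y, continuous g}) ->
  (forall y, K y -> lapl g y (lg y)) ->
  (forall y, K y -> coupling * ((c / nsq y) ^+ 2 * enorm (u ((c / nsq y) *: y)) `^ p) * g y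
      + lg y < 0) ->
  (forall y j, nsq y = r1 -> - eps * g y <= kelvin_gap c u j y) ->
  (forall y j, nsq y = r2 -> - eps * g y <= kelvin_gap c u j y) ->
  forall y j, K y -> - eps * g y <= kelvin_gap c u j y.
Proof.
move=> su c0 cr e0 K g0 cg lgP neg b1 b2 y j Ky.
have Kc x : K x -> c <= nsq x by move=> /andP[h _]; exact: le_trans h.
have KE : K = [set y | r1 <= nsq (y - 0) <= r2].
  by apply/seteqP; split => x; rewrite /K /= subr0.
have cK : compact K by rewrite KE; exact: compact_nsq_annulus.
apply: (@max_principle R n m K (fun j => kelvin_gap c u j) g eps cK) => //.
  move=> l x Kx; apply: kelvin_gap_cont => //; exact: lt_le_trans (Kc x Kx).
move=> x l mu Kx emu wx wl.
have gx := g0 x Kx.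
have mug : - mu * g x < - eps * g x by rewrite ltr_pM2r // ltrN2.
split.
  rewrite KE; apply: nbhs_nsq_annulus; rewrite subr0.
  move: (Kx) => /andP[]; rewrite !le_eqVlt => /orP[/eqP h|->].
    by have := b1 x l (esym h); rewrite wx leNgt mug.
  move=> /orP[/eqP h|->//].
  by have := b2 x l h; rewrite wx leNgt mug.
have mu0 : 0 < mu by exact: le_lt_trans emu.
have t0 : 0 <= mu * g x by rewrite mulr_ge0 // ltW.
have wx' : kelvin_gap c u l x = - (mu * g x) by rewrite wx mulNr.
have wl' i : - (mu * g x) <= kelvin_gap c u i x by rewrite -mulNr.
have [l' l'le l'P] := lapl_kelvin_gap_le su c0 (Kc x Kx) t0 wx' wl'.
exists l', (lg x); split => //; first exact: lgP.
have := neg x Kx; set Q := _ ^+ 2 * _ in l'le *.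
have : mu * (coupling * Q * g x + lg x) < 0 -> l' + mu * lg x < 0.
  by move: l'le; nra.
by move=> h h2; apply: h; rewrite pmulr_rlt0.
Qed.

End moving_spheres.

(** * Starting and continuing the moving spheres *)

Section spheres.
Set Implicit Arguments.
Unset Strict Implicit.
Variables (R : realType) (n m : nat) (p : R).
Implicit Types (u : 'rV[R]_n -> 'rV[R]_m) (z y : 'rV[R]_n) (c : R).
Hypothesis p0 : 0 < p.
Hypothesis p4 : p <= 4.
Local Notation k := ((n%:R - 2) / 2 : R).
Hypothesis kp2 : k * p <= 2.
Hypothesis n3 : (3 <= n)%N.

Local Notation solution := (solution p).
Local Notation coupling := (@coupling R m).

Lemma nsq_inv c z : 0 < nsq z -> nsq ((c / nsq z) *: z) = c ^+ 2 / nsq z.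
Proof. by move=> z0; rewrite nsqZ; field; rewrite gt_eqF. Qed.

Lemma nsq_inv_le c z : 0 < c -> c <= nsq z -> nsq ((c / nsq z) *: z) <= c.
Proof.
move=> c0 cz; have z0 : 0 < nsq z by exact: lt_le_trans cz.
by rewrite nsq_inv // ler_pdivrMr // expr2 ler_wpM2l // ltW.
Qed.

Lemma sol_bound u (r : R) : solution u -> 0 <= r ->
  exists2 M, 0 <= M & forall y, nsq y <= r -> enorm (u y) <= M.
Proof.
move=> su r0.
pose K := [set y : 'rV[R]_n | 0 <= nsq (y - 0) <= r].
have K0 : K !=set0.
  exists 0; rewrite /K /= subr0 nsq_ge0 /= (_ : nsq _ = 0) //.
  by rewrite /nsq big1 // => i _; rewrite mxE expr0n.
have [|y0 _ H] := @EVT_max_rV R n (fun y => nsq (u y)) K K0 (@compact_nsq_annulus R n 0 0 r).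
  apply: continuous_subspaceT => x.
  change (\sum_i component u i y ^+ 2 @[y --> nbhs x] --> \sum_i component u i x ^+ 2).
  by apply: cvg_sum_ord => i; apply: cvgM; exact: (@sol_cont R n m p u i su x).
exists (enorm (u y0)); first exact: enorm_ge0.
move=> y yr; rewrite ler_wsqrtr //; apply: H; apply/mem_set.
by rewrite /K /= subr0 nsq_ge0.
Qed.

Lemma k_ge : 2^-1 <= k.
Proof.
have : (3 : R) <= n%:R by rewrite ler_nat.
by lra.
Qed.

(** Comparison near infinity. The barrier |z|^(-1/2) is a supersolution once
    |z|^2 dominates the potential, and it decays more slowly than the
    transform, which is O(|z|^(-1)) or smaller; this makes the boundary
    condition on the outer sphere |z|^2 = X^4 hold up to e. *)
Lemma kelvin_gap_ge0_exterior u c r1 M : solution u -> 0 < c -> c <= r1 -> 0 <= M ->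
  (forall y, nsq y <= c -> enorm (u y) <= M) ->
  4 * (coupling * M `^ p * c ^+ 2) < r1 ->
  (forall y j, nsq y = r1 -> 0 <= kelvin_gap c u j y) ->
  forall y j, r1 <= nsq y -> 0 <= kelvin_gap c u j y.
Proof.
move=> su c0 cr M0 HM Mr b1 y j yr; rewrite leNgt; apply/negP => neg.
have r10 : 0 < r1 by exact: lt_le_trans cr.
pose a : R := - 4^-1.
pose g (z : 'rV[R]_n) := nsq z `^ a.
have y0 : 0 < nsq y by exact: lt_le_trans yr.
have gy : 0 < g y by exact: powR_gt0.
pose e := - kelvin_gap c u j y / (2 * g y).
have e0 : 0 < e by rewrite divr_gt0 ?oppr_gt0 // mulr_gt0.
have kde : kelvin_gap c u j y = - (2 * e * g y) by rewrite /e; field; rewrite gt_eqF.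
pose W := Num.sqrt c.
have W0 : 0 <= W by exact: sqrtr_ge0.
have WW : W ^+ 2 = c by rewrite sqr_sqrtr // ltW.
have WMe : 0 <= W * M / e by apply: divr_ge0; [exact: mulr_ge0|exact: ltW].
(* on the outer sphere, of squared radius X ^ 4, the barrier is 1 / X and the
   transform is at most W * M / X ^ 2 *)
pose X := 1 + nsq y + c + W * M / e.
have X1 : 1 <= X by rewrite /X; lra.
have X0 : 0 < X by exact: lt_le_trans X1.
have XX : X <= X ^+ 4 by rewrite -{1}(expr1 X) ler_weXn2l.
have yX : nsq y <= X by rewrite /X; lra.
have cX : c <= X by rewrite /X; lra.
have Xe : W * M <= e * X.
  by rewrite [e * X]mulrC -ler_pdivrMr // /X; lra.
pose K := [set z : 'rV[R]_n | r1 <= nsq z <= X ^+ 4].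
have Kpos : forall z, K z -> 0 < nsq z by move=> z /andP[h _]; exact: lt_le_trans h.
pose lg (z : 'rV[R]_n) := 2 * a * (2 * a + n%:R - 2) * nsq z `^ (a - 1).
suff : - e * g y <= kelvin_gap c u j y.
  rewrite kde; have := mulr_gt0 e0 gy; lra.
apply: (@system_comparison R n m p p0 p4 kp2 u c r1 (X ^+ 4) g lg e su c0 cr (ltW e0)).
- by move=> z /Kpos z0; exact: powR_gt0.
- move=> z /Kpos z0.
  exact: (cvg_comp _ _ (@nsq_continuous R n z) (jet2_cvg (jet2_powR a z0))).
- by move=> z /Kpos z0; exact: lapl_powR.
- move=> z Kz; have z0 := Kpos z Kz; case/andP: (Kz) => rz _.
  have cz : c <= nsq z by exact: le_trans rz.
  rewrite /g /lg; set E := enorm _ `^ p.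
  have E0 : 0 <= E by exact: powR_ge0.
  have EM : E <= M `^ p.
    apply: (ge0_ler_powR (ltW p0)); rewrite ?nnegrE ?enorm_ge0 //.
    by apply: HM; exact: nsq_inv_le.
  have -> : nsq z `^ a = nsq z * nsq z `^ (a - 1).
    rewrite -{2}(powRr1 (ltW z0)) -powRD; last by rewrite (gt_eqF z0) implybT.
    by congr (_ `^ _); ring.
  have G0 : 0 < nsq z `^ (a - 1) by exact: powR_gt0.
  set G := _ `^ (a - 1) in G0 *; set r := nsq z in z0 rz cz *.
  rewrite (_ : _ + _ = G * (coupling * E * c ^+ 2 / r + 2 * a * (2 * a + n%:R - 2))); last first.
    by field; rewrite gt_eqF.
  rewrite pmulr_rlt0 //.
  have C0 : 0 <= coupling by rewrite addr_ge0 // mulr_ge0.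
  have h1 : coupling * E * c ^+ 2 <= coupling * M `^ p * c ^+ 2.
    by apply: ler_wpM2r; [exact: sqr_ge0|apply: ler_wpM2l].
  have h2 : coupling * E * c ^+ 2 / r < 4^-1 by rewrite ltr_pdivrMr //; lra.
  have h3 : (3 : R) <= n%:R by rewrite ler_nat.
  by rewrite /a; lra.
- move=> z l zr; apply: le_trans (b1 z l zr); rewrite mulNr oppr_le0.
  by apply: mulr_ge0; [exact: ltW|exact: powR_ge0].
- move=> z l zX.
  have z0 : 0 < nsq z by rewrite zX exprn_gt0.
  have cz : c <= nsq z by rewrite zX (le_trans cX).
  have gz : g z = X^-1.
    rewrite /g zX -powR_mulrn ?(ltW X0) // -powRrM (_ : 4%:R * a = -1); last by rewrite /a; field.
    by rewrite powR_inv1 // ltW.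
  have q0 : 0 < c / nsq z by rewrite divr_gt0.
  have q1 : c / nsq z <= 1 by rewrite ler_pdivrMr // mul1r.
  have [_ u0 _] := su.
  have h1 : (c / nsq z) `^ k <= W / X ^+ 2.
    apply: (@le_trans _ _ ((c / nsq z) `^ 2^-1)).
      by apply: ger_powR; [rewrite q0 q1|exact: k_ge].
    rewrite powR12_sqrt ?(ltW q0) // zX -WW.
    rewrite (_ : W ^+ 2 / X ^+ 4 = (W / X ^+ 2) ^+ 2); last by field; rewrite gt_eqF.
    by rewrite sqrtr_sqr ger0_norm // divr_ge0 // exprn_ge0 // ltW.
  have h2 : component u l ((c / nsq z) *: z) <= M.
    by apply: le_trans (HM _ (nsq_inv_le c0 cz)); exact: coord_le_enorm.
  have h3 : kelvin c (component u l) z <= W / X ^+ 2 * M.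
    by rewrite /kelvin; apply: ler_pM; rewrite ?powR_ge0 //; exact: u0.
  have h4 : W / X ^+ 2 * M <= e / X.
    rewrite -mulrA [_^-1 * M]mulrC mulrA ler_pdivrMr ?exprn_gt0 //.
    by rewrite expr2 mulrA divfK ?gt_eqF.
  have h5 : 0 <= component u l z by exact: u0.
  by rewrite gz mulNr /kelvin_gap; lra.
- by rewrite /= yr (le_trans yX).
Qed.

(** For small spheres the barrier of kelvin_gap_ge0_exterior works in the
    whole exterior. *)
Lemma kelvin_le_start u : solution u ->
  exists2 c0, 0 < c0 & forall c, 0 < c <= c0 -> kelvin_le c u.
Proof.
move=> su; have [M M0 HM] := sol_bound su (@ler01 R).
have C0 : 0 < coupling by rewrite ltr_pwDl // mulr_ge0.
have Mp : 0 <= M `^ p by exact: powR_ge0.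
pose D := 4 * (coupling * M `^ p).
have D0 : 0 <= D by rewrite mulr_ge0 // mulr_ge0 // ltW.
exists (Num.min 1 (2^-1 / (D + 1))).
  by rewrite lt_min ltr01 divr_gt0 // ltr_wpDl.
move=> c /andP[c0]; rewrite le_min => /andP[c1 cD] z j cz.
rewrite -subr_ge0; apply: (@kelvin_gap_ge0_exterior u c c M) => //.
- by move=> y yc; apply: HM; exact: le_trans c1.
- have h : c * (D + 1) <= 2^-1 by rewrite -ler_pdivlMr // ltr_wpDl.
  have h1 : D * c < 1 by lra.
  rewrite (_ : 4 * _ = (D * c) * c); last by rewrite /D; ring.
  by rewrite -[ltRHS]mul1r ltr_pM2r.
- by move=> y l yc; rewrite /kelvin_gap kelvin_sphere // subrr.
Qed.

Lemma jet2_parabola (B b r : R) : jet2 (fun s => 1 - B * (s - b) ^+ 2) r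
  (- (2 * B * (r - b))) (- (2 * B)).
Proof.
have jl : jet2 (fun s => s + - b) r (1 + 0) (0 + 0).
  by apply: jet2D; [exact: jet2_id|exact: jet2_cst].
have := jet2D (jet2_cst 1 r) (jet2Z (- B) (jet2M jl jl)).
rewrite (_ : (fun s => _) = (fun s => 1 - B * (s - b) ^+ 2)); last first.
  by apply/funext => s; rewrite expr2 mulNr.
by move/jet2_eq; apply; ring.
Qed.

(** Comparison in a thin shell around the sphere, uniform in the radius. On
    a thin enough shell the concave parabola in |z|^2 is positive and very
    superharmonic. *)
Lemma kelvin_gap_ge0_shell u b : solution u -> 0 < b ->
  exists2 d, 0 < d & forall c, b <= c <= b + 1 -> 
    (forall y j, nsq y = b + d -> 0 <= kelvin_gap c u j y) ->
    forall y j, c <= nsq y <= b + d -> 0 <= kelvin_gap c u j y.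
Proof.
move=> su b0; have b10 : 0 <= b + 1 by rewrite addr_ge0 // ltW.
have [M M0 HM] := sol_bound su b10.
have C0 : 0 < coupling by rewrite ltr_pwDl // mulr_ge0.
have Mp : 0 <= M `^ p by exact: powR_ge0.
pose D := coupling * M `^ p.
have D0 : 0 <= D by rewrite mulr_ge0 // ltW.
(* where |z|^2 >= b, the parabola 1 - B (|z|^2 - b)^2 has Laplacian at most
   - 8 B b = - (D + 1) *)
pose B := (D + 1) / (8 * b).
have B0 : 0 < B by rewrite divr_gt0 ?ltr_wpDl // mulr_gt0.
have Bb : 8 * B * b = D + 1 by rewrite /B; field; rewrite gt_eqF.
exists (Num.min 1 (2^-1 / B)); first by rewrite lt_min ltr01 divr_gt0.
set d := Num.min _ _.
have d1 : d <= 1 by rewrite ge_min lexx.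
have dB : d * B <= 2^-1 by rewrite -ler_pdivlMr // ge_min lexx orbT.
have d0 : 0 < d by rewrite lt_min ltr01 divr_gt0.
move=> c /andP[bc cb] bd y j Ky.
have c0 : 0 < c by exact: lt_le_trans bc.
pose g (z : 'rV[R]_n) := 1 - B * (nsq z - b) ^+ 2.
pose K := [set z : 'rV[R]_n | c <= nsq z <= b + d].
have g0 : forall z, K z -> 0 < g z.
  move=> z /andP[h1 h2]; rewrite /g.
  have h3 : 0 <= nsq z - b by lra.
  have h4 : nsq z - b <= d by lra.
  have h5 : (nsq z - b) ^+ 2 <= d * 1.
    by rewrite expr2 ler_pM // (le_trans h4).
  have : B * (nsq z - b) ^+ 2 <= B * (d * 1) by rewrite ler_wpM2l // ltW.
  by lra.
pose lg (z : 'rV[R]_n) := 4 * nsq z * (- (2 * B)) + 2 * n%:R * (- (2 * B * (nsq z - b))).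
rewrite -[X in X <= _](_ : - 0 * g y = 0); last by rewrite oppr0 mul0r.
apply: (@system_comparison R n m p p0 p4 kp2 u c c (b + d) g lg 0) => //.
- move=> z _.
  exact: (cvg_comp _ _ (@nsq_continuous R n z) (jet2_cvg (jet2_parabola B b (nsq z)))).
- move=> z _.
  exact: (@lapl_radial R n (fun s => 1 - B * (s - b) ^+ 2) z _ _ (jet2_parabola B b (nsq z))).
- move=> z Kz; have gz := g0 z Kz; case/andP: (Kz) => h1 h2.
  have z0 : 0 < nsq z by exact: lt_le_trans h1.
  have q0 : 0 < c / nsq z by rewrite divr_gt0.
  have q1 : c / nsq z <= 1 by rewrite ler_pdivrMr // mul1r.
  set E := enorm _ `^ p.
  have E0 : 0 <= E by exact: powR_ge0.
  have EM : E <= M `^ p.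
    apply: (ge0_ler_powR (ltW p0)); rewrite ?nnegrE ?enorm_ge0 //.
    by apply: HM; apply: le_trans (nsq_inv_le c0 h1) cb.
  have g1 : g z <= 1 by rewrite /g gerBl mulr_ge0 ?sqr_ge0 // ltW.
  have h3 : (c / nsq z) ^+ 2 * E <= M `^ p.
    by rewrite -[leRHS]mul1r; apply: ler_pM => //; [exact: sqr_ge0|exact: exprn_ile1 (ltW q0) q1].
  have h4 : coupling * ((c / nsq z) ^+ 2 * E) <= D by rewrite /D ler_wpM2l // ltW.
  have h5 : coupling * ((c / nsq z) ^+ 2 * E) * g z <= D * 1.
    apply: ler_pM => //; last exact: ltW.
    by apply: mulr_ge0; [exact: ltW|apply: mulr_ge0 => //; exact: sqr_ge0].
  have h6 : 0 <= n%:R * (B * (nsq z - b)).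
    by rewrite mulr_ge0 // mulr_ge0 ?(ltW B0) // subr_ge0 (le_trans bc).
  have h7 : B * b <= B * nsq z by rewrite ler_wpM2l ?(ltW B0) // (le_trans bc).
  by rewrite /lg; lra.
- by move=> z l zc; rewrite oppr0 mul0r /kelvin_gap kelvin_sphere // subrr.
- by move=> z l zd; rewrite oppr0 mul0r; exact: bd.
Qed.

Lemma kelvin_joint_cont u c z j : solution u -> 0 < c -> 0 < nsq z ->
  {for (z, c), continuous (fun x : 'rV[R]_n * R => kelvin x.2 (component u j) x.1)}.
Proof.
move=> su c0 z0.
have cf : {for (z, c), continuous (fun x : 'rV[R]_n * R => x.1)} by exact: cvg_fst.
have cs : {for (z, c), continuous (fun x : 'rV[R]_n * R => x.2)} by exact: cvg_snd.
have cq : {for (z, c), continuous (fun x : 'rV[R]_n * R => x.2 / nsq x.1)}.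
  apply: continuousM => //; apply: continuousV; first by rewrite gt_eqF.
  exact: (cvg_comp _ _ cf (@nsq_continuous R n z)).
apply: continuousM.
  exact: (cvg_comp _ _ cq (jet2_cvg (jet2_powR k (divr_gt0 c0 z0)))).
have cz : {for (z, c), continuous (fun x : 'rV[R]_n * R => (x.2 / nsq x.1) *: x.1)}.
  exact: continuousZ.
exact: (cvg_comp _ _ cz (@sol_cont R n m p u j su _)).
Qed.

Lemma kelvin_gap_joint_cont u c z j : solution u -> 0 < c -> 0 < nsq z ->
  {for (z, c), continuous (fun x : 'rV[R]_n * R => kelvin_gap x.2 u j x.1)}.
Proof.
move=> su c0 z0; apply: continuousB; last exact: kelvin_joint_cont.
have cf : {for (z, c), continuous (fun x : 'rV[R]_n * R => x.1)} by exact: cvg_fst.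
exact: (cvg_comp _ _ cf (@sol_cont R n m p u j su _)).
Qed.

Lemma kelvin_gap_trivial u c j y : (forall x, u x 0 j = 0) -> kelvin_gap c u j y = 0.
Proof. by move=> H; rewrite /kelvin_gap /kelvin /component !H mulr0 subr0. Qed.

(** If at b each component of u vanishes or is strictly above its transform,
    the inequality persists for c slightly larger: by compactness on a
    middle annulus, and by the comparison principles in the thin shell
    inside it and in the region outside it. *)
Lemma kelvin_le_continuation u b : solution u -> 0 < b ->
  (forall j, (forall x, u x 0 j = 0) \/ (forall y, b < nsq y -> 0 < kelvin_gap b u j y)) ->
  exists2 e, 0 < e & forall c, b <= c < b + e -> kelvin_le c u.
Proof.
move=> su b0 H.
have [d d0 Hd] := kelvin_gap_ge0_shell su b0.
have b10 : 0 <= b + 1 by rewrite addr_ge0 // ltW.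
have [M M0 HM] := sol_bound su b10.
have C0 : 0 < coupling by rewrite ltr_pwDl // mulr_ge0.
have Mp : 0 <= M `^ p by exact: powR_ge0.
pose r2 := b + d + 1 + 4 * (coupling * M `^ p * (b + 1) ^+ 2).
have D0 : 0 <= coupling * M `^ p * (b + 1) ^+ 2.
  by rewrite mulr_ge0 ?sqr_ge0 // mulr_ge0 // ltW.
pose K := [set z : 'rV[R]_n | b + d <= nsq (z - 0) <= r2].
have cK : near_covering K by apply/compact_near_coveringP; exact: compact_nsq_annulus.
have : \forall c \near b, K `<=` (fun z => forall j, 0 <= kelvin_gap c u j z).
  apply: (cK R (nbhs b) (fun c z => forall j, 0 <= kelvin_gap c u j z)) => x /andP[]; rewrite subr0 => bx _.
  have bx' : b < nsq x by apply: lt_le_trans bx; rewrite ltrDl.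
  have x0 : 0 < nsq x by exact: lt_trans bx'.
  have Hj j : \forall s \near (x, b), 0 <= kelvin_gap s.2 u j s.1.
    have [Hz|Hp] := H j.
      by near=> s; rewrite kelvin_gap_trivial.
    have := @kelvin_gap_joint_cont u b x j su b0 x0 => /cvgr_gt/(_ 0 (Hp x bx')).
    by apply: filterS => s; exact: ltW.
  have := @filter_forall _ _ _ (nbhs (x, b)) _ Hj.
  by move=> [[P Q] /= [nP nQ] sub]; exists (P, Q).
move=> /nbhs_ballP[e /= e0 He].
exists (Num.min (Num.min e 1) d); first by rewrite !lt_min e0 ltr01 d0.
move=> c /andP[bc]; rewrite -ltrBlDl !lt_min => /andP[/andP[ce c1] cd] z j cz.
rewrite -subr_ge0 -/(kelvin_gap c u j z).
have c0 : 0 < c by exact: lt_le_trans bc.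
have cb : ball b e c by rewrite -ball_normE /= ler0_norm ?subr_le0 // opprB.
have mid : forall y l, b + d <= nsq y <= r2 -> 0 <= kelvin_gap c u l y.
  by move=> y l hy; apply: (He c cb); rewrite /K /= subr0.
have [zd|zd] := leP (nsq z) (b + d).
  apply: (Hd c); last by rewrite cz.
    by rewrite bc /=; lra.
  by move=> y l yd; apply: mid; rewrite yd lexx /r2; lra.
have [zr|zr] := leP (nsq z) r2; first by apply: mid; rewrite zr ltW.
apply: (@kelvin_gap_ge0_exterior u c r2 M) => //.
- by rewrite /r2; lra.
- by move=> y yc; apply: HM; lra.
- have : coupling * M `^ p * c ^+ 2 <= coupling * M `^ p * (b + 1) ^+ 2.
    apply: ler_wpM2l; first by rewrite mulr_ge0 // ltW.
    by rewrite ler_pXn2r ?nnegrE ?(ltW c0) //; lra.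
  by rewrite /r2; lra.
- by move=> y l yr; apply: mid; rewrite yr lexx /r2; lra.
- exact: ltW.
Unshelve. all: by end_near. Qed.

End spheres.

(** * The dichotomy for the moving spheres *)

Section dichotomy.
Set Implicit Arguments.
Unset Strict Implicit.
Variables (R : realType) (n m : nat) (p : R).
Implicit Types (u : 'rV[R]_n -> 'rV[R]_m) (x y z : 'rV[R]_n) (c : R).
Hypothesis p0 : 0 < p.
Hypothesis p4 : p <= 4.
Local Notation k := ((n%:R - 2) / 2 : R).
Hypothesis kp2 : k * p <= 2.
Hypothesis n3 : (3 <= n)%N.

Local Notation solution := (solution p).

Lemma sol_supersol u j y : solution u -> supersol (component u j) y.
Proof.
move=> su; have [Cu u0 eq] := su; split; first exact: (@sol_cont R n m p u j su y).
  exact: u0.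
exists (laplace (component u j) y); last exact: lapl_C2.
by rewrite -oppr_ge0 eq mulr_ge0 ?powR_ge0 // u0.
Qed.

Lemma sol_pos u j x y : solution u -> u x 0 j != 0 -> 0 < u y 0 j.
Proof.
move=> su nz; have [_ u0 _] := su.
apply: (@strong_max_ball R n (component u j) x y (nsq (y - x) + 1)).
- exact: leq_trans n3.
- by move=> z _; exact: sol_supersol.
- by rewrite /component lt_neqAle eq_sym nz u0.
- by rewrite ltrDl.
Qed.

Lemma weight_le1 c z : 0 < c -> c <= nsq z -> (c / nsq z) `^ (2 - k * p) <= 1.
Proof.
move=> c0 cz; have z0 : 0 < nsq z by exact: lt_le_trans cz.
have q0 : 0 < c / nsq z by rewrite divr_gt0.
have q1 : c / nsq z <= 1 by rewrite ler_pdivrMr // mul1r.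
have e0 : 0 <= 2 - k * p by rewrite subr_ge0.
have := ge0_ler_powR e0 (ltW q0 : c / nsq z \in Num.nneg) (ler01 : (1 : R) \in Num.nneg) q1.
by rewrite powR1.
Qed.

Lemma kelvin_le_supersol u c j y : solution u -> 0 < c -> kelvin_le c u -> c < nsq y ->
  supersol (kelvin_gap c u j) y.
Proof.
move=> su c0 gc cy; have y0 : 0 < nsq y by exact: lt_trans cy.
split; first exact: (@kelvin_gap_cont R n m p).
  by rewrite /kelvin_gap subr_ge0; apply: gc; exact: ltW.
eexists; last exact: (lapl_kelvin_gap j su c0 y0).
rewrite subr_le0.
have bu i : kelvin_vec c u y 0 i <= u y 0 i by rewrite kelvin_vecE; apply: gc; exact: ltW.
have b0 := kelvin_vec_ge0 c y su.
set X := _ * kelvin_vec c u y 0 j.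
have X0 : 0 <= X by rewrite mulr_ge0 ?powR_ge0.
apply: (@le_trans _ _ X).
  by rewrite -[leRHS]mul1r ler_wpM2r // weight_le1 // ltW.
apply: ler_pM => //; first exact: powR_ge0.
by apply: (ge0_ler_powR (ltW p0)); rewrite ?nnegrE ?enorm_ge0 // ler_enorm.
Qed.

(** If one nonzero component agrees with its transform outside the sphere,
    equality of the two Laplacians forces the factor (c / |z|^2)^(2 - k p)
    to be 1 and all components to agree. *)
Lemma kelvin_le_rigid u c j y : solution u -> 0 < c -> kelvin_le c u -> c < nsq y ->
  0 < u y 0 j -> (forall z, c < nsq z -> kelvin_gap c u j z = 0) ->
  k * p = 2 /\ u y = kelvin_vec c u y.
Proof.
move=> su c0 gc cy uj H; have y0 : 0 < nsq y by exact: lt_trans cy.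
have L := lapl_kelvin_gap j su c0 y0.
have L0 : lapl (kelvin_gap c u j) y 0.
  apply: lapl_ext (lapl_cst 0 y).
  have H1 : \forall z \near y, c < nsq z.
    by have := @nsq_continuous R n y => /cvgr_gt; exact.
  by near=> z; rewrite H //; near: z.
have /eqP := lapl_uniq L L0.
have bu i : kelvin_vec c u y 0 i <= u y 0 i by rewrite kelvin_vecE; apply: gc; exact: ltW.
have b0 := kelvin_vec_ge0 c y su.
have ebu : kelvin_vec c u y 0 j = u y 0 j.
  by rewrite kelvin_vecE; have := H y cy; rewrite /kelvin_gap /component; lra.
rewrite ebu mulrA -mulrBl mulf_eq0 (gt_eqF uj) orbF subr_eq0 => /eqP E.
set th := _ `^ (2 - _) in E; set B := enorm (kelvin_vec _ _ _) in E; set A := enorm (u y) in E.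
have B0 : 0 < B by apply: lt_le_trans (coord_le_enorm _ j); rewrite ebu.
have BA : B <= A by exact: ler_enorm.
have A0 : 0 < A by exact: lt_le_trans BA.
have BAp : B `^ p <= A `^ p.
  by apply: (ge0_ler_powR (ltW p0)); rewrite ?nnegrE ?enorm_ge0.
have Bp : 0 < B `^ p by exact: powR_gt0.
have th1 : th <= 1 by apply: weight_le1 => //; exact: ltW.
have tB : th = 1.
  apply/eqP; rewrite eq_le th1 /=; rewrite leNgt; apply/negP => tl.
  have : th * B `^ p < 1 * B `^ p by rewrite ltr_pM2r.
  by rewrite E mul1r ltNge BAp.
split.
  apply/eqP; rewrite eq_le kp2 /= leNgt; apply/negP => lt2.
  have q0 : 0 < c / nsq y by rewrite divr_gt0.
  have q1 : c / nsq y < 1 by rewrite ltr_pdivrMr // mul1r.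
  have e0 : 0 < 2 - k * p by rewrite subr_gt0.
  have := gt0_ltr_powR e0 (ltW q0 : c / nsq y \in Num.nneg) (ler01 : (1 : R) \in Num.nneg) q1.
  by rewrite powR1 -/th tB ltxx.
apply/esym; apply: enorm_eq => //; rewrite -/A -/B.
move: E; rewrite tB mul1r; apply: powR_injective => //; rewrite nnegrE; exact: ltW.
Unshelve. all: by end_near. Qed.

Lemma kelvin_le_closed u b : solution u -> 0 < b ->
  (forall c, 0 < c < b -> kelvin_le c u) -> kelvin_le b u.
Proof.
move=> su b0 H z j; rewrite le_eqVlt => /orP[/eqP bz|bz].
  by rewrite kelvin_sphere.
have z0 : 0 < nsq z by exact: lt_trans bz.
rewrite leNgt; apply/negP => lt.
have ck : {for b, continuous (fun c => kelvin c (component u j) z)}.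
  have cp : {for b, continuous (fun c : R => (z, c))}.
    exact: (cvg_pair (cvg_cst z) cvg_id).
  exact: (cvg_comp _ _ cp (@kelvin_joint_cont R n m p u b z j su b0 z0)).
have N1 : \forall c \near b, component u j z < kelvin c (component u j) z.
  by move: ck => /cvgr_gt; exact.
have N2 : \forall c \near b, 0 < c by exact: lt_nbhsr.
have : \forall c \near b, 0 < c /\ component u j z < kelvin c (component u j) z.
  by near=> c; split; near: c.
move=> /nbhs_ballP[e /= e0 He].
pose c := b - Num.min (e / 2) (b / 2).
have mn : 0 < Num.min (e / 2) (b / 2) by rewrite lt_min !divr_gt0.
have cb : c < b by rewrite /c gtrBl.
have [c0 lc] : 0 < c /\ component u j z < kelvin c (component u j) z.
  apply: He; rewrite -ball_normE /= /c opprB addrCA subrr addr0 gtr0_norm //.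
  by rewrite gt_min ltr_pdivrMr // ltr_pMr // ltr1n.
have : kelvin_le c u by apply: H; rewrite c0.
move=> /(_ z j (ltW (lt_trans cb bz))); by rewrite leNgt lc.
Unshelve. all: by end_near. Qed.

(** Either the spheres can be enlarged for ever, or they stop at a sphere in
    which u is invariant, which is only possible for the critical exponent. *)
Lemma moving_spheres_dichotomy u : solution u ->
  (forall c, 0 < c -> kelvin_le c u) \/
  (exists c, [/\ 0 < c, k * p = 2 & forall z, c <= nsq z -> u z = kelvin_vec c u z]).
Proof.
move=> su.
have [?|] := pselect (forall c, 0 < c -> kelvin_le c u); first by left.
move=> /existsNP[c1 /not_implyP[c10 ng]]; right.
pose S := [set c : R | 0 < c /\ forall c', 0 < c' <= c -> kelvin_le c' u].
have [c0 c00 Hc0] := kelvin_le_start p0 p4 kp2 n3 su.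
have Sc0 : S c0 by [].
have Sub : ubound S c1.
  move=> c [c0' Hc]; rewrite leNgt; apply/negP => lt.
  by apply: ng; apply: Hc; rewrite c10 ltW.
have hS : has_sup S by split; [exists c0|exists c1].
pose b := sup S.
have b0 : 0 < b by apply: lt_le_trans c00 _; apply: ub_le_sup => //; exists c1.
have below c : 0 < c < b -> kelvin_le c u.
  move=> /andP[cp cb].
  have [s [_ Ss] cs] : exists2 s, S s & c < s.
    have bc : 0 < b - c by rewrite subr_gt0.
    have [s Ss] := sup_adherent bc hS; rewrite opprB addrC subrK => h.
    by exists s.
  by apply: Ss; rewrite cp ltW.
have gb : kelvin_le b u by exact: kelvin_le_closed.
exists b.
have [Hj|] := pselect (forall j, (forall x, u x 0 j = 0) \/
    (forall y, b < nsq y -> 0 < kelvin_gap b u j y)).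
  have [e e0 He] := kelvin_le_continuation p0 p4 kp2 n3 su b0 Hj.
  have : S (b + e / 2).
    split; first by rewrite addr_gt0 // divr_gt0.
    move=> c /andP[cp cb]; have [cb'|cb'] := ltP c b; first by apply: below; rewrite cp.
    by apply: He; rewrite cb' /=; lra.
  move=> Sb; have : b + e / 2 <= b by apply: ub_le_sup => //; exists c1.
  by have : 0 < e / 2 by [rewrite divr_gt0]; lra.
move=> /existsNP[j /not_orP[/existsNP[x0 ux0] /existsNP[y0 /not_implyP[by0 ky0]]]].
have uj y : 0 < u y 0 j by apply: (sol_pos y su (x := x0)); exact/eqP.
have kd0 z : b < nsq z -> kelvin_gap b u j z = 0.
  move=> bz; have [_ kz _] := kelvin_le_supersol j su b0 gb bz.
  apply/eqP; rewrite eq_le kz andbT leNgt; apply/negP => kz0.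
  apply: ky0; apply: (@strong_max_exterior R n (kelvin_gap b u j) z y0 b) => //.
    exact: leq_trans n3.
  by move=> y yb; exact: kelvin_le_supersol.
split => //.
  by have [] := kelvin_le_rigid su b0 gb by0 (uj y0) kd0.
move=> z; rewrite le_eqVlt => /orP[/eqP bz|bz].
  by apply/rowP => i; rewrite kelvin_vecE kelvin_sphere.
by have [] := kelvin_le_rigid su b0 gb bz (uj z) kd0.
Qed.

End dichotomy.

(** * Translation invariance *)

Section shift_solution.
Set Implicit Arguments.
Unset Strict Implicit.
Variables (R : realType) (n m : nat) (p : R).
Implicit Types (u : 'rV[R]_n -> 'rV[R]_m) (x y z : 'rV[R]_n) (c : R).

Lemma derive_shift_rV (f : 'rV[R]_n -> R) (v x : 'rV[R]_n) :
  'D_v (fun y => f (y + x)) = (fun y => 'D_v f (y + x)).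
Proof.
apply/funext => y; rewrite /derive /=.
by under [in RHS]eq_fun do rewrite addrA.
Qed.

Lemma differentiable_shift_rV (f : 'rV[R]_n -> R) x : (forall y, differentiable f y) ->
  forall y, differentiable (fun y => f (y + x)) y.
Proof.
move=> df y; apply: (@differentiable_comp _ _ _ _ (fun y => y + x) f) => //.
Qed.

Lemma C2_fun_shift (f : 'rV[R]_n -> R) x : C2_fun f -> C2_fun (fun y => f (y + x)).
Proof.
move=> [d1 d2]; split => [y|i y]; first exact: differentiable_shift_rV.
rewrite derive_shift_rV.
exact: (@differentiable_shift_rV ('D_(delta_mx 0 i) f) x (d2 i) y).
Qed.

Lemma laplace_shift (f : 'rV[R]_n -> R) x y : laplace (fun y => f (y + x)) y = laplace f (y + x).
Proof.
apply: eq_bigr => i _; rewrite (derive_shift_rV f).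
exact: (congr1 (fun g => g y) (derive_shift_rV ('D_(delta_mx 0 i) f) _ x)).
Qed.

Lemma solution_shift u x : solution p u -> solution p (fun y => u (y + x)).
Proof.
move=> [Cu u0 eq]; split => [i||i y].
- exact: (@C2_fun_shift (component u i) x (Cu i)).
- by move=> y; exact: u0.
- by have := eq i (y + x); rewrite -(@laplace_shift (component u i) x y).
Qed.

End shift_solution.

(** * Behaviour at infinity *)

Section at_infinity.
Set Implicit Arguments.
Unset Strict Implicit.
Variables (R : realType) (n m : nat) (p : R).
Implicit Types (u : 'rV[R]_n -> 'rV[R]_m) (x y z e : 'rV[R]_n) (c h : R).
Local Notation k := ((n%:R - 2) / 2 : R).
Hypothesis n3 : (3 <= n)%N.

(** The Kelvin transform of u about x at the point e / h, times h^(-2k), in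
    a form that makes sense and is continuous at h = 0. *)
Definition kelvin_inf u x c e j h : R :=
  (c / nsq (e - h *: x)) `^ k *
  u ((c * h / nsq (e - h *: x)) *: (e - h *: x) + x) 0 j.

Lemma kelvin_infE u x c e j h : 0 < h -> 0 < c -> 0 < nsq (e - h *: x) ->
  kelvin c (component (fun y => u (y + x)) j) (h^-1 *: e - x) = (h ^+ 2) `^ k * kelvin_inf u x c e j h.
Proof.
move=> h0 c0 N0.
have hN : h != 0 by rewrite gt_eqF.
have E : h^-1 *: e - x = h^-1 *: (e - h *: x).
  by rewrite scalerBr scalerA mulVf // scale1r.
rewrite /kelvin /component E nsqZ /kelvin_inf; set N := nsq _ in N0 *.
have NN : N != 0 by rewrite gt_eqF.
have -> : c / (h^-1 ^+ 2 * N) = h ^+ 2 * (c / N) by field; rewrite hN NN.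
rewrite powRM ?sqr_ge0 //; last by rewrite divr_ge0 // ltW.
rewrite -mulrA; congr (_ * (_ * u (_ + _) 0 j)).
by rewrite scalerA; congr (_ *: _); field; rewrite hN NN.
Qed.

Lemma kelvin_inf_cvg u x c e j : solution p u -> 0 < c -> nsq e = 1 ->
  kelvin_inf u x c e j h @[h --> 0^'+] --> c `^ k * u x 0 j.
Proof.
move=> su c0 e1; apply: cvg_at_right_filter.
have ev : {for 0, continuous (fun h => e - h *: x)}.
  apply: continuousB; first exact: cst_continuous.
  by apply: continuousZr_tmp; exact: cvg_id.
have E0 : e - 0 *: x = e by rewrite scale0r subr0.
have nv : {for 0, continuous (fun h => nsq (e - h *: x))}.
  exact: (cvg_comp _ _ ev (@nsq_continuous R n _)).
have nN : nsq (e - 0 *: x) != 0 by rewrite E0 e1 oner_eq0.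
have iv : {for 0, continuous (fun h => (nsq (e - h *: x))^-1)}.
  by apply: continuousV.
have cv : {for 0, continuous (fun h => c / nsq (e - h *: x))}.
  by apply: continuousM => //; exact: cst_continuous.
have chv : {for 0, continuous (fun h => c * h / nsq (e - h *: x))}.
  apply: continuousM => //; apply: continuousM; first exact: cst_continuous.
  exact: cvg_id.
have wv : {for 0, continuous (fun h => (c * h / nsq (e - h *: x)) *: (e - h *: x) + x)}.
  by apply: continuousD; [exact: continuousZ|exact: cst_continuous].
have c1 : 0 < c / nsq (e - 0 *: x) by rewrite E0 e1 divr1.
have pv : {for 0, continuous (fun h => (c / nsq (e - h *: x)) `^ k)}.
  exact: (cvg_comp _ _ cv (jet2_cvg (jet2_powR k c1))).
have uv : {for 0, continuous (fun h =>
    component u j ((c * h / nsq (e - h *: x)) *: (e - h *: x) + x))}.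
  exact: (cvg_comp _ _ wv (@sol_cont R n m p u j su _)).
have T : {for (0 : R), continuous (kelvin_inf u x c e j)} by exact: continuousM pv uv.
have E : kelvin_inf u x c e j 0 = c `^ k * u x 0 j.
  by rewrite /kelvin_inf mulr0 mul0r E0 e1 divr1 scale0r add0r.
by rewrite -E; exact: T.
Qed.

Lemma nsq_near0 x e c : nsq e = 1 -> 0 < c ->
  \forall h \near 0^'+, [/\ 0 < h, 0 < nsq (e - h *: x) & c <= nsq (h^-1 *: e - x)].
Proof.
move=> e1 c0.
have nv : nsq (e - h *: x) @[h --> 0^'+] --> (1 : R).
  apply: cvg_at_right_filter; rewrite -e1 -[in X in _ --> X](subr0 e) -(scale0r x).
  have ev : {for (0 : R), continuous (fun h => e - h *: x)}.
    apply: continuousB; first exact: cst_continuous.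
    by apply: continuousZr_tmp; exact: cvg_id.
  exact: (cvg_comp _ _ ev (@nsq_continuous R n _)).
have N1 : \forall h \near 0^'+, 2^-1 < nsq (e - h *: x).
  by move: nv => /cvgr_gt; apply; lra.
near=> h.
have h0 : 0 < h by [].
have hN : 2^-1 < nsq (e - h *: x) by near: h.
have hc : h < 1 by near: h; exact: nbhs_right_lt.
have hc2 : h < 2^-1 / c by near: h; apply: nbhs_right_lt; rewrite divr_gt0.
split => //; first by apply: lt_trans hN.
have -> : h^-1 *: e - x = h^-1 *: (e - h *: x).
  by rewrite scalerBr scalerA mulVf ?gt_eqF // scale1r.
rewrite nsqZ exprVn mulrC ler_pdivlMr ?exprn_gt0 //; apply: le_trans (ltW hN).
have : h * c < 2^-1 by rewrite -ltr_pdivlMr.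
have : 0 <= c * h * (1 - h) by rewrite mulr_ge0 ?mulr_ge0 ?subr_ge0 // ltW.
by rewrite expr2; lra.
Unshelve. all: by end_near. Qed.

(** Both sides are values at h = 0 of kelvin_inf, and for small h > 0 these
    functions are separated by h^(-2k) u(e / h). *)
Lemma infinity_le u x x' c c' j : solution p u -> 0 < c -> 0 < c' ->
  kelvin_le c (fun y => u (y + x)) ->
  (forall z, c' <= nsq z -> u (z + x') = kelvin_vec c' (fun y => u (y + x')) z) ->
  c `^ k * u x 0 j <= c' `^ k * u x' 0 j.
Proof.
move=> su c0 c0' gc eqc.
have n0 : (0 < n)%N by exact: leq_trans n3.
pose e : 'rV[R]_n := 1 *: delta_mx 0 (Ordinal n0).
have e1 : nsq e = 1 by rewrite nsq_delta expr1n.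
have L1 := @kelvin_inf_cvg u x c e j su c0 e1.
have L2 := @kelvin_inf_cvg u x' c' e j su c0' e1.
apply: ler_cvg_to L1 L2 _.
have A1 := @nsq_near0 x e c e1 c0.
have A2 := @nsq_near0 x' e c' e1 c0'.
near=> h.
have [h0 N1 cN1] : [/\ 0 < h, 0 < nsq (e - h *: x) & c <= nsq (h^-1 *: e - x)] by near: h.
have [_ N2 cN2] : [/\ 0 < h, 0 < nsq (e - h *: x') & c' <= nsq (h^-1 *: e - x')] by near: h.
have h2 : 0 < (h ^+ 2) `^ k by rewrite powR_gt0 // exprn_gt0.
rewrite -(ler_pM2l h2) -!kelvin_infE //.
apply: le_trans (gc _ j cN1) _; rewrite /component subrK.
have := congr1 (fun w : 'rV[R]_m => w 0 j) (eqc _ cN2).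
by rewrite /= kelvin_vecE subrK => ->.
Unshelve. all: by end_near. Qed.

(** The points y and z are exchanged by an inversion about z + s d, with
    d = z - y; as s tends to infinity the conformal factor at y tends to 1. *)
Lemma kelvin_le_const u : solution p u ->
  (forall x c, 0 < c -> kelvin_le c (fun y => u (y + x))) ->
  forall y z j, u z 0 j <= u y 0 j.
Proof.
move=> su H y z j.
have [->//|yz] := eqVneq y z.
pose d := z - y.
have d0 : 0 < nsq d.
  rewrite lt_neqAle nsq_ge0 andbT eq_sym; apply: contra_neq yz => E.
  apply/rowP => i; have := coord_sq_le d i; rewrite E => h.
  have : d 0 i ^+ 2 == 0 by rewrite eq_le h sqr_ge0.
  by rewrite sqrf_eq0 !mxE subr_eq0 => /eqP.
(* inversion about z + s d, with squared radius s (1 + s) |d|^2 *)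
have key (s : R) : 0 < s -> (s / (1 + s)) `^ k * u z 0 j <= u y 0 j.
  move=> s0; have s1 : 0 < 1 + s by rewrite addr_gt0.
  have := H (z + s *: d) (s * (1 + s) * nsq d) _ (- (1 + s) *: d) j.
  rewrite /kelvin /component nsqZ sqrrN => HH.
  have E1 : s * (1 + s) * nsq d / ((1 + s) ^+ 2 * nsq d) = s / (1 + s).
    by field; rewrite !gt_eqF.
  have E2 : (s / (1 + s)) *: (- (1 + s) *: d) + (z + s *: d) = z.
    rewrite scalerA (_ : s / (1 + s) * - (1 + s) = - s); last by field; rewrite gt_eqF.
    by rewrite addrCA scaleNr addNr addr0.
  have E3 : - (1 + s) *: d + (z + s *: d) = y.
    by apply/rowP => i; rewrite !mxE; ring.
  move: HH; rewrite E1 E2 E3; apply; first by rewrite !mulr_gt0.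
  by rewrite ler_pM2r // expr2 ler_wpM2r ?(ltW s1) // lerDr.
have cv : (1 + h)^-1 `^ k * u z 0 j @[h --> 0^'+] --> u z 0 j.
  apply: cvg_at_right_filter.
  have iv : {for (0 : R), continuous (fun h : R => (1 + h)^-1)}.
    apply: continuousV; first by rewrite addr0 oner_eq0.
    by apply: continuousD; [exact: cst_continuous|exact: cvg_id].
  have i0 : 0 < (1 + 0 : R)^-1 by rewrite addr0 invr1.
  have pv : {for (0 : R), continuous (fun h : R => (1 + h)^-1 `^ k)}.
    exact: (cvg_comp _ _ iv (jet2_cvg (jet2_powR k i0))).
  have cv : {for (0 : R), continuous (fun=> u z 0 j)} by exact: cst_continuous.
  have T := continuousM pv cv.
  have E : (1 + 0 : R)^-1 `^ k * u z 0 j = u z 0 j.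
    by rewrite addr0 invr1 powR1 mul1r.
  by rewrite -[X in _ --> X]E; exact: T.
apply: ler_cvg_to cv (cvg_cst (u y 0 j)) _.
near=> h.
have h0 : 0 < h by [].
rewrite (_ : (1 + h)^-1 = h^-1 / (1 + h^-1)); first by apply: key; rewrite invr_gt0.
by field; rewrite (gt_eqF h0) gt_eqF // addr_gt0.
Unshelve. all: by end_near. Qed.

End at_infinity.

(** * A functional equation on the line *)

Section inversion_equation.
Set Implicit Arguments.
Unset Strict Implicit.
Variables (R : realType).
Implicit Types (f D : R -> R) (s t h : R).

Lemma cvg_right0 (phi : R -> R) : phi h @[h --> 0^'+] --> (0 : R) ->
  (\forall h \near 0^'+, 0 < phi h) -> phi h @[h --> 0^'+] --> 0^'+.
Proof.
move=> c0 pos P HP.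
have H : \forall h \near 0^'+, 0 < phi h -> P (phi h) by exact: (c0 _ HP).
suff : \forall h \near 0^'+, P (phi h) by [].
by apply: filterS2 H pos => h; exact.
Qed.

(** The equation with t = 1/h expresses f at infinity through f near s. *)
Lemma inversion_equation_asymptotics f s d : (forall t, 0 < f t) ->
  is_derive s (1 : R) f d ->
  (forall t, 0 < t -> f s <= t ^+ 2 -> f (s + t) = t ^+ 2 / f s * f (s + f s / t)) ->
  h * f (s + h^-1) - h^-1 @[h --> 0^'+] --> d.
Proof.
move=> f0 df eq.
have fs := f0 s; have fN : f s != 0 by rewrite gt_eqF.
have jg : is_derive (0 : R) (1 : R) (fun h => s + f s * h) (f s).
  have := jet2_derive (jet2D (jet2_cst s 0) (jet2Z (f s) (jet2_id 0))).
  by rewrite add0r mulr1.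
have dH : is_derive (0 : R) (1 : R) (fun h => f (s + f s * h)) (d * f s).
  by apply: (@is_derive1_comp _ f (fun h => s + f s * h)); rewrite mulr0 addr0.
have cH : h^-1 *: (f (s + f s * (h *: (1 : R) + 0)) - f (s + f s * 0)) @[h --> 0^'+] --> d * f s.
  by apply: cvg_dnbhs_at_right; case: dH => + <-; exact.
have cH2 : (f s)^-1 * (h^-1 *: (f (s + f s * (h *: (1 : R) + 0)) - f (s + f s * 0))) @[h --> 0^'+] --> d.
  have := cvgM (cvg_cst (f s)^-1) cH; rewrite [_^-1 * (d * _)]mulrC mulfK //; exact.
apply: cvg_trans cH2; apply: near_eq_cvg; near=> h.
have h0 : 0 < h by [].
have h1 : h < 1 by near: h; exact: nbhs_right_lt.
have h2 : h < (f s)^-1 by near: h; apply: nbhs_right_lt; rewrite invr_gt0.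
have hN : h != 0 by rewrite gt_eqF.
have hb : f s <= h^-1 ^+ 2.
  rewrite exprVn -[_^-1]mul1r ler_pdivlMr ?exprn_gt0 //.
  have : h * f s < 1 by rewrite -ltr_pdivlMr // mul1r.
  have : 0 <= h * f s * (1 - h).
    by apply: mulr_ge0; [apply: mulr_ge0; exact: ltW|rewrite subr_ge0 ltW].
  by rewrite expr2; lra.
have hi : 0 < h^-1 by rewrite invr_gt0.
rewrite [h *: 1]mulr1 addr0 mulr0 addr0 (eq _ hi hb).
rewrite invrK /GRing.scale /=; by field; rewrite hN fN.
Unshelve. all: by end_near. Qed.

(** Comparing the asymptotics based at s and at 0 gives f' s = f' 0 + 2 s. *)
Lemma inversion_equation_quadratic f D : (forall t, 0 < f t) ->
  (forall s, is_derive s (1 : R) f (D s)) ->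
  (forall s t, 0 < t -> f s <= t ^+ 2 -> f (s + t) = t ^+ 2 / f s * f (s + f s / t)) ->
  forall s, f s = s ^+ 2 + D 0 * s + f 0.
Proof.
move=> f0 df eq.
have Ds s : D s = D 0 + 2 * s.
  have L1 := inversion_equation_asymptotics f0 (df s) (eq s).
  have L0 := inversion_equation_asymptotics f0 (df 0) (eq 0).
  have iv : {for (0 : R), continuous (fun h => 1 + s * h)}.
    apply: continuousD; first exact: cst_continuous.
    by apply: continuousM; [exact: cst_continuous|exact: cvg_id].
  have i1 : 1 + s * 0 = 1 by rewrite mulr0 addr0.
  have qv : {for (0 : R), continuous (fun h => h / (1 + s * h))}.
    apply: continuousM; first exact: cvg_id.
    by apply: continuousV => //; rewrite i1 oner_eq0.
  have pos : \forall h \near 0^'+, 0 < 1 + s * h.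
    have /cvg_at_right_filter : (1 + s * h) @[h --> (0 : R)] --> (1 + s * 0) by exact: iv.
    by rewrite i1 => /cvgr_gt; exact.
  (* the asymptotics at 0 are used at h / (1 + s h), whose inverse is s + 1/h *)
  have c0 : h / (1 + s * h) @[h --> 0^'+] --> 0^'+.
    apply: cvg_right0.
      have /cvg_at_right_filter : (h / (1 + s * h)) @[h --> (0 : R)] --> (0 / (1 + s * 0)).
        exact: qv.
      by rewrite mul0r.
    by near=> h; rewrite divr_gt0 //; near: h.
  have L2 := cvg_comp _ _ c0 L0.
  have L3 : (1 + s * h) @[h --> 0^'+] --> (1 : R).
    by apply: cvg_at_right_filter; rewrite -[X in _ --> X]i1; exact: iv.
  have L4 : 2 * s + s ^+ 2 * h @[h --> 0^'+] --> 2 * s.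
    apply: cvg_at_right_filter.
    have : {for (0 : R), continuous (fun h => 2 * s + s ^+ 2 * h)}.
      apply: continuousD; first exact: cst_continuous.
      by apply: continuousM; [exact: cst_continuous|exact: cvg_id].
    by rewrite /prop_for /continuous_at mulr0 addr0.
  pose E0 (h : R) := h * f (0 + h^-1) - h^-1.
  have L5 : (1 + s * h) * E0 (h / (1 + s * h)) + (2 * s + s ^+ 2 * h) @[h --> 0^'+]
      --> D 0 + 2 * s.
    by rewrite -[X in X + _](mul1r (D 0)); exact: cvgD (cvgM L3 L2) L4.
  suff L6 : h * f (s + h^-1) - h^-1 @[h --> 0^'+] --> D 0 + 2 * s.
    exact: (cvg_unique _ L1 L6).
  apply: cvg_trans L5; apply: near_eq_cvg; near=> h.
  have h0 : 0 < h by [].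
  have p1 : 0 < 1 + s * h by near: h.
  rewrite /E0 invf_div add0r.
  rewrite (_ : (1 + s * h) / h = s + h^-1); last by field; rewrite gt_eqF.
  by field; rewrite !gt_eqF.
move=> s.
have dg t : is_derive t (1 : R) (fun t => f t - (t ^+ 2 + D 0 * t)) 0.
  have j1 := jet2_derive (jet2D (jet2M (jet2_id t) (jet2_id t)) (jet2Z (D 0) (jet2_id t))).
  apply: is_derive_eq (is_deriveB (df t) j1) _.
  by rewrite Ds; ring.
have := @is_derive_0_is_cst R (fun t => f t - (t ^+ 2 + D 0 * t)) s 0 dg.
by rewrite expr0n /= mulr0 addr0 subr0; lra.
Unshelve. all: by end_near. Qed.

End inversion_equation.

(** * Functions that are affine along lines *)

Section affine.
Set Implicit Arguments.
Unset Strict Implicit.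
Variables (R : realType) (n : nat).

(** A function that is affine along each line is affine: additivity is the
    midpoint property. *)
Lemma affine_on_lines (psi : 'rV[R]_n -> R) :
  (forall x v, exists b, forall s : R, psi (x + s *: v) = psi x + s * b) ->
  forall x, psi x = psi 0 + \sum_i x 0 i * (psi (delta_mx 0 i) - psi 0).
Proof.
move=> H.
pose g x := psi x - psi 0.
have gZ (s : R) x : g (s *: x) = s * g x.
  have [b Hb] := H 0 x; have := Hb 1; have := Hb s.
  by rewrite /g !add0r scale1r => -> ->; ring.
have gD x y : g (x + y) = g x + g y.
  have [b Hb] := H x (y - x); have := Hb 1; have := Hb 2^-1.
  have -> : x + 1 *: (y - x) = y by rewrite scale1r addrC subrK.
  have -> : x + 2^-1 *: (y - x) = 2^-1 *: (x + y).
    by apply/rowP => i; rewrite !mxE; field.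
  have := gZ 2^-1 (x + y); rewrite /g; lra.
move=> x; have g0 : g 0 = 0 by rewrite /g subrr.
suff : g x = \sum_i x 0 i * g (delta_mx 0 i) by rewrite /g; lra.
rewrite [in LHS](row_sum_delta x) (big_morph g gD g0).
by apply: eq_bigr => i _; rewrite gZ.
Qed.

End affine.

(** * Solutions invariant under an inversion about each point *)

Section bubbles.
Set Implicit Arguments.
Unset Strict Implicit.
Variables (R : realType) (n m : nat) (p : R).
Variables (u : 'rV[R]_n -> 'rV[R]_m) (c : 'rV[R]_n -> R) (j0 : 'I_m).
Implicit Types (x y z v : 'rV[R]_n).
Local Notation k := ((n%:R - 2) / 2 : R).
Hypothesis p0 : 0 < p.
Hypothesis kp2 : k * p = 2.
Hypothesis n3 : (3 <= n)%N.
Hypothesis su : solution p u.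
Hypothesis uj0 : forall x, 0 < u x 0 j0.
Hypothesis c0 : forall x, 0 < c x.
Hypothesis eqc : forall x z, c x <= nsq z -> u (z + x) = kelvin_vec (c x) (fun y => u (y + x)) z.

Let k0 : 0 < k.
Proof. by apply: lt_le_trans (k_ge R n3); rewrite invr_gt0. Qed.

Let L : 'rV[R]_m := c 0 `^ k *: u 0.

(** The limit of |y|^(2k) u(y) at infinity, which does not depend on the
    centre. *)
Lemma bubble_amplitude x j : c x `^ k * u x 0 j = L 0 j.
Proof.
have G y : kelvin_le (c y) (fun z => u (z + y)).
  move=> z l cz; rewrite -kelvin_vecE -eqc //.
have le y z : c y `^ k * u y 0 j <= c z `^ k * u z 0 j.
  by apply: (@infinity_le R n m p n3 u y z (c y) (c z) j su) => //; exact: eqc.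
by rewrite mxE; apply/eqP; rewrite eq_le !le.
Qed.

(** The invariance of u, written for the squared radius c. *)
Lemma radius_inversion x z : c x <= nsq z ->
  c (z + x) = nsq z / c x * c (x + (c x / nsq z) *: z).
Proof.
move=> cz; have z0 : 0 < nsq z by exact: lt_le_trans cz.
have q0 : 0 < c x / nsq z by rewrite divr_gt0.
suff -> : c (x + (c x / nsq z) *: z) = c x / nsq z * c (z + x).
  by field; rewrite !gt_eqF.
have n1 : c (x + (c x / nsq z) *: z) \in Num.nneg by rewrite nnegrE ltW.
have n2 : c x / nsq z * c (z + x) \in Num.nneg by rewrite nnegrE ltW // mulr_gt0.
apply: (powR_injective k0 n1 n2).
rewrite /= (powRM _ (ltW q0) (ltW (c0 _))).
have E := congr1 (fun w : 'rV[R]_m => w 0 j0) (eqc cz).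
rewrite /= kelvin_vecE /kelvin /component in E.
have A1 := bubble_amplitude (z + x) j0.
have A2 := bubble_amplitude (x + (c x / nsq z) *: z) j0.
have U1 := uj0 (z + x); have U2 := uj0 (x + (c x / nsq z) *: z).
rewrite [_ *: z + x]addrC in E.
apply: (mulIf (lt0r_neq0 U2)); rewrite A2 -A1 E; ring.
Qed.

Lemma radius_line_derivable x v (s : R) :
  exists d, is_derive s (1 : R) (fun t => c (x + t *: v)) d.
Proof.
have [/(_ j0) [dU _] _ _] := su.
have L0 : 0 < L 0 j0 by rewrite mxE mulr_gt0 // powR_gt0.
have E : (fun t : R => c (x + t *: v)) =
         (fun t : R => (L 0 j0 *: (component u j0 (t *: v + x))^-1) `^ k^-1).
  apply/funext => t; rewrite [x + _]addrC -(bubble_amplitude (t *: v + x) j0).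
  rewrite /GRing.scale /= /component mulfK ?gt_eqF // -powRrM divff ?gt_eqF //.
  by rewrite powRr1 // ltW.
have H1 : is_derive s (1 : R) (fun t : R => component u j0 (t *: v + x))
    ('D_v (component u j0) (s *: v + x)).
  by apply: is_derive_line; exact: diff_derivable.
have gN : component u j0 (s *: v + x) != 0 by rewrite gt_eqF //; exact: uj0.
have H2 := is_deriveV gN H1.
have H3 := is_deriveZ (L 0 j0) H2.
have pos : 0 < L 0 j0 *: (component u j0 (s *: v + x))^-1.
  by rewrite /GRing.scale /= divr_gt0 //; exact: uj0.
have H4 := @is_derive1_comp R (fun r : R => r `^ k^-1) _ s _ _ (is_derive1_powR k^-1 pos) H3.
by eexists; rewrite E; exact: H4.
Qed.

Lemma radius_quadratic x v : exists b, forall s : R,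
  c (x + s *: v) = s ^+ 2 * nsq v + b * s + c x.
Proof.
have [v0|v0] := eqVneq (nsq v) 0.
  have vz : v = 0.
    apply/rowP => i; have := coord_sq_le v i; rewrite v0 => h.
    have : v 0 i ^+ 2 == 0 by rewrite eq_le h sqr_ge0.
    by rewrite sqrf_eq0 mxE => /eqP.
  by exists 0 => s; rewrite v0 vz scaler0 addr0; ring.
have ev : 0 < enorm v by rewrite lt_neqAle enorm_ge0 andbT eq_sym -sqrf_eq0 enorm_sqr.
pose w := (enorm v)^-1 *: v.
have w1 : nsq w = 1 by rewrite nsqZ -enorm_sqr exprVn mulVf // expf_neq0 // gt_eqF.
have vw (s : R) : s *: v = (s * enorm v) *: w.
  by rewrite scalerA -mulrA divff ?gt_eqF // mulr1.
clearbody w.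
have [D HD] := choice (radius_line_derivable x w).
have := @inversion_equation_quadratic R (fun t => c (x + t *: w)) D (fun t => c0 _) HD.
move=> Q; have {Q} := Q _; rewrite scale0r addr0 => Q.
exists (D 0 * enorm v) => s; rewrite vw Q; last first.
  move=> t r r0 hr.
  have zr : nsq (r *: w) = r ^+ 2 by rewrite nsqZ w1 mulr1.
  have := @radius_inversion (x + t *: w) (r *: w); rewrite zr => /(_ hr).
  rewrite (_ : r *: w + _ = x + (t + r) *: w); last by rewrite scalerDl addrC addrA.
  move=> ->; congr (_ * c _); rewrite scalerDl addrA scalerA; congr (_ + _ *: _).
  by field; rewrite gt_eqF.
by rewrite exprMn enorm_sqr; ring.
Qed.

Lemma radius_form : exists z r2, 0 < r2 /\ forall x, c x = r2 + nsq (x - z).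
Proof.
pose psi x := c x - nsq x.
have lin x v : exists b, forall s : R, psi (x + s *: v) = psi x + s * b.
  have [b Hb] := radius_quadratic x v.
  exists (b - 2 * dot x v) => s; rewrite /psi Hb nsqD dotZr nsqZ; ring.
have A := affine_on_lines lin.
pose z : 'rV[R]_n := \row_i (- (psi (delta_mx 0 i) - psi 0) / 2).
have C x : c x = (psi 0 - nsq z) + nsq (x - z).
  rewrite nsqD nsqN (_ : c x = psi x + nsq x); last by rewrite /psi subrK.
  rewrite A (_ : dot x (- z) = 2^-1 * \sum_i x 0 i * (psi (delta_mx 0 i) - psi 0)).
    by field.
  by rewrite /dot mulr_sumr; apply: eq_bigr => i _; rewrite !mxE; field.
exists z, (psi 0 - nsq z); split => //.
by have := c0 z; rewrite {1}C subrr (_ : nsq 0 = 0) ?addr0 // /nsq big1 // => i _; rewrite mxE expr0n.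
Qed.

Lemma bubble_form : exists (z : 'rV[R]_n) (r : R) (e : 'rV[R]_m),
  [/\ 0 <= r, enorm e = 1, nonneg_vec e & forall x, u x = bubble z r x *: e].
Proof.
have [z [C [C0 HC]]] := radius_form.
have [Cu u0 eq] := su.
have L0 : 0 < L 0 j0 by rewrite mxE mulr_gt0 // powR_gt0.
have Lnn : nonneg_vec L by move=> i; rewrite mxE mulr_ge0 ?powR_ge0 ?u0.
have EL : 0 < enorm L by apply: lt_le_trans (coord_le_enorm L j0).
have uEj x j : u x 0 j = c x `^ (- k) * L 0 j.
  rewrite -(bubble_amplitude x j) mulrA -powRD ?addNr ?powRr0 ?mul1r //.
  by rewrite (gt_eqF (c0 x)) implybT.
have uE x : u x = c x `^ (- k) *: L.
  by apply/rowP => j; rewrite uEj [RHS]mxE.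
have zz : nsq (z - z) = 0 by rewrite subrr /nsq big1 // => i _; rewrite mxE expr0n.
have cz : c z = C by rewrite HC zz addr0.
have Nk : 2 * n%:R * k = n%:R * (n%:R - 2) :> R by field.
(* the equation at the centre z fixes the amplitude *)
have amp : enorm L `^ p = n%:R * (n%:R - 2) * C.
  pose F2 := - k * ((- k - 1) * C `^ (- k - 2)).
  have jF : jet2 (fun r : R => (C + r) `^ (- k)) (nsq (z - z)) (- k * C `^ (- k - 1)) F2.
    have jl : jet2 (fun r : R => C + r) 0 1 0.
      by have := jet2D (jet2_cst C 0) (jet2_id 0); rewrite !add0r.
    have C00 : 0 < C + 0 by rewrite addr0.
    rewrite zz; apply: jet2_eq (jet2_comp jl (jet2_powR (- k) C00)) _ _.
      by rewrite (addr0 C) mulr1.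
    by rewrite (addr0 C) /F2; ring.
  have l1 := lapl_shift (lapl_radial jF).
  have l2 := laplZ (L 0 j0) l1.
  have E : (fun y => L 0 j0 * (C + nsq (y - z)) `^ (- k)) = component u j0.
    by apply/funext => y; rewrite /component uEj HC mulrC.
  rewrite E in l2.
  have := lapl_uniq (lapl_C2 z (Cu j0)) l2; rewrite zz => l3.
  have := eq j0 z; rewrite l3 uEj uE cz => l4.
  have Ck : C `^ (- k - 1) = C `^ (- k) / C.
    by rewrite powRB ?powRr1 ?(ltW C0) // (gt_eqF C0) implybT.
  have P : C `^ (- k) `^ p = C ^- 2.
    by rewrite -powRrM mulNr kp2 powR_invn // ltW.
  rewrite enormZ ?powR_ge0 // powRM ?powR_ge0 ?enorm_ge0 // P Ck in l4.
  have Cp : 0 < C `^ (- k) by exact: powR_gt0.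
  have CN : C != 0 by rewrite gt_eqF.
  have : C ^- 2 * C `^ (- k) * L 0 j0 * (enorm L `^ p) =
         C ^- 2 * C `^ (- k) * L 0 j0 * (n%:R * (n%:R - 2) * C).
    rewrite -Nk; move: l4.
    rewrite (_ : C ^- 2 * enorm L `^ p * (_ * _) = C ^- 2 * C `^ (- k) * L 0 j0 * (enorm L `^ p)).
      by move=> <-; field.
    by ring.
  apply: mulfI; rewrite !mulf_neq0 ?invr_eq0 ?expf_neq0 ?gt_eqF //.
have nR : 0 < n%:R :> R by rewrite ltr0n (leq_trans _ n3).
have n20 : 0 < n%:R * (n%:R - 2) :> R.
  by rewrite -Nk; apply: mulr_gt0 => //; apply: mulr_gt0.
have EE : enorm L = (n%:R * (n%:R - 2)) `^ ((n%:R - 2) / 4) * C `^ (k / 2).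
  have -> : (n%:R - 2) / 4 = k / 2 :> R by field.
  rewrite -powRM ?(ltW n20) ?(ltW C0) // -amp -powRrM (_ : p * (k / 2) = 1).
    by rewrite powRr1 // enorm_ge0.
  by rewrite mulrA [p * k]mulrC kp2 divff.
have r0 : 0 < Num.sqrt C by rewrite sqrtr_gt0.
exists z, (Num.sqrt C), ((enorm L)^-1 *: L); split.
- exact: ltW.
- by rewrite enormZ ?invr_ge0 ?enorm_ge0 // mulVf // gt_eqF.
- by move=> i; rewrite mxE mulr_ge0 ?invr_ge0 ?enorm_ge0.
- move=> x; rewrite uE /bubble sqr_sqrtr ?(ltW C0) // enorm_sqr -HC [RHS]scalerA.
  congr (_ *: _).
  rewrite powRM ?sqrtr_ge0 ?invr_ge0 ?(ltW (c0 x)) //.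
  have -> : (c x)^-1 `^ k = c x `^ (- k).
    by rewrite powRN -powR_inv1 ?(ltW (c0 x)) // -powRrM mulN1r powRN.
  have -> : Num.sqrt C `^ k = C `^ (k / 2).
    by rewrite -powR12_sqrt ?(ltW C0) // -powRrM mulrC.
  by rewrite mulrA -EE mulrAC divff ?mul1r // gt_eqF.
Qed.

End bubbles.

(** * Classification of the entire solutions *)

Section classification.
Set Implicit Arguments.
Unset Strict Implicit.
Variables (R : realType) (n m : nat).
Implicit Types (u f : 'rV[R]_n -> 'rV[R]_m) (x y z : 'rV[R]_n).

Lemma derive_component f j v x : derivable f x v ->
  derivable (component f j) x v /\ 'D_v (component f j) x = component ('D_v f) j x.
Proof.
move=> df; split; first by move/derivable_mxP : df; exact.
by rewrite /component derive_mx // mxE.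
Qed.

Lemma continuous_component f j : continuous f -> continuous (component f j).
Proof.
move=> cf x; exact: (cvg_comp _ _ (cf x) (@coord_continuous R 1 m 0 j (f x))).
Qed.

Lemma nonneg_solutionP (alpha : R) u : nonneg_solution alpha setT u ->
  solution (alpha - 1) u.
Proof.
move=> [_ [cu c1 c2] u0 eq].
have D1 i j : 'D_(delta_mx 0 i) (component u j) = component (partial i u) j.
  apply/funext => x; have [d _] := c1 i.
  by have [] := derive_component j (d x I).
have D2 i k j : 'D_(delta_mx 0 k) (component (partial i u) j) = component (partial k (partial i u)) j.
  apply/funext => x; have [d _] := c2 k i.
  by have [] := derive_component j (d x I).
split => [j|x|j x]; last 2 first.
- exact: u0.
- have := congr1 (fun w : 'rV[R]_m => w 0 j) (eq x I); rewrite !mxE => <-.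
  rewrite /laplacian summxE /laplace; congr (- _); apply: eq_bigr => i _.
  by rewrite D1; have := congr1 (fun g => g x) (D2 i i j) => /= ->.
split => [|i]; apply: C1_differentiable.
- by move=> i x; have [d _] := c1 i; have [] := derive_component j (d x I).
- move=> i; rewrite D1; apply: continuous_component => x; have [_ c] := c1 i; exact: c.
- move=> k x; rewrite D1; have [d _] := c2 k i.
  by have [] := derive_component j (d x I).
- move=> k; rewrite D1 D2; apply: continuous_component => x; have [_ c] := c2 k i; exact: c.
Qed.

Lemma const_solution_zero (p : R) u : solution p u ->
  (forall y z j, u z 0 j <= u y 0 j) -> forall x, u x = 0.
Proof.
move=> [Cu u0 eq] H x; apply/rowP => j; rewrite [RHS]mxE.
have L : lapl (component u j) x 0.
  apply: lapl_ext (lapl_cst (u x 0 j) x).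
  by near=> y; apply/eqP; rewrite /component eq_le !H.
have := eq j x; rewrite (lapl_uniq (lapl_C2 x (Cu j)) L) oppr0 => /esym/eqP.
rewrite mulf_eq0 => /orP[|/eqP//].
rewrite powR_eq0 => /andP[/eqP E _]; apply/eqP.
by rewrite eq_le u0 andbT -E coord_le_enorm.
Unshelve. all: by end_near. Qed.

End classification.

Theorem theorem1p1 (R : realType) (n m : nat) (alpha : R)
    (u : 'rV[R]_n -> 'rV[R]_m)
    (hn : (3 <= n)%N) (hm : (1 <= m)%N)
    (halpha1 : 1 < alpha) (halpha2 : alpha <= crit_exp R n)
    (hu : nonneg_solution alpha setT u) :
  (alpha < crit_exp R n -> forall x, u x = 0) /\
  (alpha = crit_exp R n ->
   exists (z : 'rV[R]_n) (r : R) (e : 'rV[R]_m),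
     [/\ 0 <= r, enorm e = 1, nonneg_vec e &
         forall x, u x = bubble z r x *: e]).
Proof.
have su := nonneg_solutionP hu.
have n3R : 3 <= n%:R :> R by rewrite ler_nat.
have n2 : 0 < n%:R - 2 :> R by lra.
have p0 : 0 < alpha - 1 by lra.
have critE : crit_exp R n = 1 + 4 / (n%:R - 2).
  by rewrite /crit_exp; field; rewrite gt_eqF.
have kpE : (n%:R - 2) / 2 * (4 / (n%:R - 2)) = 2 :> R by field; rewrite gt_eqF.
have k0 : 0 < (n%:R - 2) / 2 :> R by lra.
have kp2 : (n%:R - 2) / 2 * (alpha - 1) <= 2.
  by rewrite -[leRHS]kpE ler_pM2l //; move: halpha2; rewrite critE; lra.
have p4 : alpha - 1 <= 4.
  apply: (@le_trans _ _ (4 / (n%:R - 2))); first by move: halpha2; rewrite critE; lra.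
  by rewrite ler_pdivrMr //; lra.
have dich x := moving_spheres_dichotomy p0 p4 kp2 hn (solution_shift x su).
have zero : (forall x c, 0 < c -> kelvin_le c (fun y => u (y + x))) -> forall x, u x = 0.
  by move=> H; exact: (const_solution_zero su (kelvin_le_const su H)).
split=> [lt|eqa].
  apply: zero => x; case: (dich x) => // -[c [_ kp _]].
  suff : (n%:R - 2) / 2 * (alpha - 1) < 2 by rewrite kp ltxx.
  by rewrite -[ltRHS]kpE ltr_pM2l //; move: lt; rewrite critE; lra.
have kp : (n%:R - 2) / 2 * (alpha - 1) = 2.
  by rewrite eqa critE addrAC subrr add0r kpE.
have [u_eq0|] := pselect (forall x, u x = 0).
  exists 0, 0, (1 *: delta_mx 0 (Ordinal hm)); split => //.
  - by rewrite enorm_nsq nsq_delta expr1n sqrtr1.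
  - by move=> i; rewrite scale1r mxE; case: (_ && _).
  - by move=> x; rewrite u_eq0 bubble0 // scale0r.
move=> /existsNP[x0 ux0].
have [j0 uj0] : exists j, u x0 0 j != 0.
  apply: contrapT => /forallNP H; apply: ux0; apply/rowP => j; rewrite [RHS]mxE.
  by apply/eqP/negPn/negP; exact: H.
have upos y : 0 < u y 0 j0 by exact: (sol_pos hn y su uj0).
have [x1 [c1 [c10 eq1]]] : exists x1 c1, 0 < c1 /\
    forall z, c1 <= nsq z -> u (z + x1) = kelvin_vec c1 (fun y => u (y + x1)) z.
  apply: contrapT => H; apply: ux0; apply: zero => x.
  case: (dich x) => // -[c [c0 _ E]]; exfalso; apply: H.
  by exists x, c.
have fin x : exists c, 0 < c /\
    forall z, c <= nsq z -> u (z + x) = kelvin_vec c (fun y => u (y + x)) z.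
  case: (dich x) => [G|[c [c0 _ E]]]; last by exists c.
  exfalso.
  pose B := c1 `^ ((n%:R - 2) / 2) * u x1 0 j0 / u x 0 j0.
  have B0 : 0 < B by rewrite divr_gt0 // mulr_gt0 // powR_gt0.
  (* a radius too large for infinity_le, as c ^ k = B + 1 *)
  pose c := (B + 1) `^ ((n%:R - 2) / 2)^-1.
  have c0 : 0 < c by rewrite powR_gt0 // addr_gt0.
  have := @infinity_le R n m (alpha - 1) hn u x x1 c c1 j0 su c0 c10 (G c c0) eq1.
  rewrite /c -powRrM mulVf ?gt_eqF // powRr1 ?addr_ge0 ?(ltW B0) //.
  by rewrite -ler_pdivlMr // -/B leNgt ltrDl ltr01.
have [c Hc] := choice fin.
apply: (@bubble_form R n m (alpha - 1) u c j0 kp hn su upos).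
- by move=> x; have [] := Hc x.
- by move=> x; have [_] := Hc x; exact.
Qed.
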